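(* Consider the boundary value problem $$By'+\Omega(x)y=\lambda y,\quad 0<x<\pi,\qquad y_1(0)=0,\qquad (\lambda+h_1)y_1(\pi)+h_2y_2(\pi)=0. \quad (\ast)$$ (i) The eigenvalues $\lambda_n$ ($n\in\mathbb{Z}$) of $(\ast)$ are $$\lambda_n=\lambda_n^0+\epsilon_n,\qquad \{\epsilon_n\}\in l_2,$$ where $\lambda_n^0=n$ are the zeros of the function $\lambda\sin\lambda\pi$. For large $n$, the eigenvalues are simple. (ii) The eigenfunctions of $(\ast)$ can be represented in the form $$\varphi(x,\lambda_n)=\begin{pmatrix}\sin nx\\-\cos nx\end{pmatrix}+\begin{pmatrix}\zeta_n^{(1)}(x)\\ \zeta_n^{(2)}(x)\end{pmatrix},$$ where $\sum_{n=-\infty}^{\infty}\left\{|\zeta_n^{(1)}(x)|^2+|\zeta_n^{(2)}(x)|^2\right\}\le C$, with $C$ a positive number. (iii) The normalizing numbers of $(\ast)$ are $$\alpha_n=\pi+\tau_n,\qquad \{\tau_n\}\in l_2 .$$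
   Context: Here $B=\begin{pmatrix}0&1\\-1&0\end{pmatrix}$, $\Omega(x)=\begin{pmatrix}p(x)&q(x)\\ q(x)&-p(x)\end{pmatrix}$, $y=\begin{pmatrix}y_1(x)\\ y_2(x)\end{pmatrix}$, $p,q$ are real valued functions in $L_2(0,\pi)$, $\lambda$ is a spectral parameter, $h_1,h_2$ are real numbers and $h_2>0$. $\varphi(x,\lambda)=(\varphi_1,\varphi_2)^T$ is the solution of $By'+\Omega y=\lambda y$ with $\varphi(0,\lambda)=\begin{pmatrix}0\\-1\end{pmatrix}$. The eigenvalues of the problem are the zeros $\lambda_n$ of the characteristic function $\Delta(\lambda)=(\lambda+h_1)\varphi_1(\pi,\lambda)+h_2\varphi_2(\pi,\lambda)$, and $\varphi(x,\lambda_n)$ are the eigenfunctions. The normalizing numbers are $$\alpha_n=\int_0^\pi\left(|\varphi_1(x,\lambda_n)|^2+|\varphi_2(x,\lambda_n)|^2\right)dx+\frac{1}{h_2}|\varphi_1(\pi,\lambda_n)|^2 .$$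
   Formalization: The complete list of eigenvalues is indexed by the integers together with one further index numbered 0, because 0 is a double zero of λ sin λπ; a complete list indexed by n∈Z alone with λ_n−n in l_2 is impossible (e.g. p=q=0, h_1=0, h_2=1). *)

(* Defs.v *)
From HB Require Import structures.
From mathcomp Require Import all_boot all_order all_algebra.
From mathcomp Require Import all_classical all_reals all_analysis.
From mathcomp Require Import complex.

Set Implicit Arguments.
Unset Strict Implicit.
Unset Printing Implicit Defensive.

Import Order.TTheory GRing.Theory Num.Theory.
Import numFieldNormedType.Exports.

Local Open Scope classical_set_scope.
Local Open Scope ring_scope.
Local Open Scope complex_scope.

Section Complex.
Variable R : realType.
Local Notation C := R[i].

(* |z|^2 as a real number ([`|z|] itself lives in [R[i]]) *)
Definition sqnorm (z : C) : R := complex.Re z ^+ 2 + complex.Im z ^+ 2.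

(* sin (a + i b) = sin a cosh b + i cos a sinh b *)
Definition csin (z : C) : C :=
  let: a +i* b := z in
  (sin a * ((expR b + expR (- b)) / 2)) +i*
  (cos a * ((expR b - expR (- b)) / 2)).

(* z is a zero of f of order exactly m (m = 0 means f z != 0).  The functions
   concerned are entire; for them this is the usual order of vanishing. *)
Definition zero_order (f : C -> C) (z : C) (m : nat) : Prop :=
  exists g : C -> C, [/\ {for z, continuous (g : C^o -> C^o)}, g z != 0
    & forall w, f w = (w - z) ^+ m * g w].

Definition simple_zero (f : C -> C) (z : C) : Prop := zero_order f z 1.

(* The family l lists all the zeros of f, each one repeated as often as its
   multiplicity. *)
Definition enumerates_zeros (I : Type) (f : C -> C) (l : I -> C) : Prop :=
  forall z, exists m, zero_order f z m /\ ([set i | l i = z] #= `I_m)%card.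

Definition col2 (K : Type) (a b : K) : 'cV[K]_2 :=
  \col_i (if i == 0 then a else b).

Definition mx2 (K : Type) (a b c d : K) : 'M[K]_2 :=
  \matrix_(i, j) (if i == 0 then if j == 0 then a else b
                  else if j == 0 then c else d).

End Complex.

(* The function z sin(pi z) has a simple zero at every nonzero integer and a
   double zero at 0, so its zeros counted with multiplicity are indexed by the
   integers together with one further index for the second zero at 0: [Some n]
   has number n, and [None] has number 0. *)
Definition eig_index : Type := option int.
HB.instance Definition _ := Choice.on eig_index.
Definition eig_number (i : eig_index) : int := odflt 0 i.

Section BoundaryValueProblem.
Variable R : realType.
Local Notation C := R[i].
Local Notation mu := (@lebesgue_measure R).

Definition lambda0 (i : eig_index) : C := (eig_number i)%:~R.

Definition ell2 (a : eig_index -> C) : Prop :=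
  (\esum_(i in [set: eig_index]) (sqnorm (a i))%:E < +oo)%E.

(* real-valued functions in L_2(0, pi), extended by 0 outside ]0, pi[ *)
Definition L2_0pi (f : R -> R) : Prop :=
  f \_ `]0, pi[ \in Lfun mu 2%:E.

(* y is absolutely continuous on [0, pi] with (a.e.) derivative y' *)
Definition ac_derivative (y y' : R -> C) : Prop :=
  [/\ mu.-integrable `[0, pi] (fun t => (complex.Re (y' t))%:E),
      mu.-integrable `[0, pi] (fun t => (complex.Im (y' t))%:E)
    & forall x, x \in `[0, pi] ->
        y x = y 0 + ((\int[mu]_(t in `[0, x]) complex.Re (y' t)) +i*
                     (\int[mu]_(t in `[0, x]) complex.Im (y' t)))].

Definition Bmx : 'M[C]_2 := mx2 0 1 (- 1) 0.

Variables p q : R -> R.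

Definition Omega (x : R) : 'M[C]_2 :=
  mx2 (p x)%:C (q x)%:C (q x)%:C (- (p x)%:C).

(* B y' + Omega(x) y = lam y on 0 < x < pi; as p and q are merely square
   integrable, y is absolutely continuous and the equation holds a.e. *)
Definition solution (lam : C) (y : R -> 'cV[C]_2) : Prop :=
  exists y' : R -> 'cV[C]_2,
    (forall i, ac_derivative (fun x => y x i 0) (fun x => y' x i 0)) /\
    {ae mu, forall x, x \in `]0, pi[ ->
      Bmx *m y' x + Omega x *m y x = lam *: y x}.

Variables h1 h2 : R.

Definition bvp_eigenfunction (lam : C) (y : R -> 'cV[C]_2) : Prop :=
  [/\ solution lam y,
      y 0 0 0 = 0,
      (lam + h1%:C) * y pi 0 0 + h2%:C * y pi 1 0 = 0
    & exists2 x, x \in `[0, pi] & y x != 0].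

Definition bvp_eigenvalue (lam : C) : Prop := exists y, bvp_eigenfunction lam y.

(* [phi x lam] is the solution phi(x, lam), for every complex lam *)
Definition is_phi (phi : R -> C -> 'cV[C]_2) : Prop :=
  forall lam, solution lam (phi ^~ lam) /\ phi 0 lam = col2 0 (- 1).

Definition char_fun (phi : R -> C -> 'cV[C]_2) (lam : C) : C :=
  (lam + h1%:C) * phi pi lam 0 0 + h2%:C * phi pi lam 1 0.

Definition normalizing_number (phi : R -> C -> 'cV[C]_2) (lam : C) : R :=
  (\int[mu]_(x in `[0, pi]) (sqnorm (phi x lam 0 0) + sqnorm (phi x lam 1 0)))
  + h2^-1 * sqnorm (phi pi lam 0 0).

End BoundaryValueProblem.

(* Main.v *)
Require Import Defs.
From mathcomp Require Import all_boot all_order all_algebra.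
From mathcomp Require Import all_classical all_reals all_analysis.
From mathcomp Require Import complex.
From mathcomp Require Import measurable_realfun ring lra.

Import Order.TTheory GRing.Theory Num.Theory.
Import numFieldNormedType.Exports.

(** The problem is self-adjoint although the spectral parameter enters the
    boundary condition: because h2 > 0, Green's identity of a solution with
    itself shows that every zero of the characteristic function Delta is real
    ([char_fun_zero_real]).  For a real zero r, Green's identity without
    conjugation, between the solutions for w and for r, reads
      Delta(w) phi1(pi, r) =
        (w - r) (h2 int phi(x, w).phi(x, r) dx + phi1(pi, r) phi1(pi, w)),
    and at w = r the second factor is h2 times the normalizing number of r,
    hence positive: every zero is simple ([char_fun_zero_simple]).  Only
    the continuity in w of the terms of this formula is used.

    The zeros, being real, are counted by a monotone angle.  For real lambda
    write phi1 = exp(rho) sin(theta) and phi2 = - exp(rho) cos(theta)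
    ([pruefer_exists]); then
      theta' = lambda + p cos(2 theta) + q sin(2 theta),
      rho'   = p sin(2 theta) - q cos(2 theta).
    The function theta(pi, lambda) + atan((lambda + h1) / h2) - pi / 2 is
    continuous, strictly increasing and onto, and lambda is an eigenvalue
    exactly when its value is k pi for an integer k.  The arc tangent gains pi
    between - infinity and + infinity, so that the eigenvalue of index k lies
    near k for k >= 0 and near k + 1 for k <= - 2, while k = - 1 gives the
    eigenvalue to be added to the integers ([eigenvalue_localisation]).

    All three asymptotic statements follow from one estimate.  If lambda is at
    bounded distance of the integer n, then theta - n x varies with a square
    integrable speed, and an integration by parts bounds theta(x) - lambda x
    and rho(x) by the primitives of p and q against cos(2 n x) and sin(2 n x)
    ([pruefer_remainder]).  Bessel's inequality on [0, x] makes these square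
    summable in n, uniformly in x ([remainder_summable]).  At x = pi, together
    with the O(1/n) gap between theta and n pi, this gives the eigenvalues; at
    a general x it gives the eigenfunctions; integrated over x it gives the
    normalizing numbers.

    As p and q are merely square integrable, solutions are only absolutely
    continuous.  The calculus used for them rests on one elementary fact
    ([quadratic_increments_constant]): a function whose increments are bounded
    by a multiple of the squared increments of a continuous monotone function
    is constant.  It yields the chain rule, and from it products, Gronwall's
    inequality and integration by parts. *)

Local Open Scope classical_set_scope.
Local Open Scope ring_scope.
Local Open Scope complex_scope.

Set Implicit Arguments.
Unset Strict Implicit.

(** * Integrals over subintervals of a compact interval *)

Section Integral.
Context {R : realType} (T : R).
Local Notation mu := (@lebesgue_measure R).

Implicit Types (g h u v : R -> R) (a b c x t : R).

Definition integ (g : R -> R) : Prop := mu.-integrable `[0, T] (EFin \o g).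

(** The factors that preserve integrability.  Measurability is preferred to
    continuity because quotients with a vanishing denominator occur. *)
Definition bmeas (u : R -> R) := measurable_fun `[0, T] u /\
  exists M : R, forall x : R, x \in `[0, T] -> `|u x| <= M.
Definition prim (g : R -> R) (x : R) : R := \int[mu]_(t in `[0, x]) g t.

Lemma integ_eq g h : {in `[0, T], g =1 h} -> integ g -> integ h.
Proof.
move=> gh; apply: eq_integrable => // x; rewrite inE => xT.
by rewrite /= gh.
Qed.

Lemma bmeas_eq g h : {in `[0, T], g =1 h} -> bmeas g -> bmeas h.
Proof.
move=> gh [mg [M gM]]; split; last by exists M => x xT; rewrite -gh// gM.
by apply: eq_measurable_fun mg => x; rewrite inE => xT; rewrite gh.
Qed.

Lemma bmeas_cst c : bmeas (cst c).
Proof. by split; [exact: measurable_cst | exists `|c|]. Qed.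

Lemma bmeasD u v : bmeas u -> bmeas v -> bmeas (fun x => u x + v x).
Proof.
move=> [mu_ [M uM]] [mv [N vN]]; split; first exact: measurable_funD.
exists (M + N) => x xT; apply: le_trans (ler_normD _ _) _.
by apply: lerD; [exact: uM | exact: vN].
Qed.

Lemma bmeasM u v : bmeas u -> bmeas v -> bmeas (fun x => u x * v x).
Proof.
move=> [mu_ [M uM]] [mv [N vN]]; split; first exact: measurable_funM.
exists (M * N) => x xT; rewrite normrM.
by apply: ler_pM => //; [exact: uM | exact: vN].
Qed.

Lemma bmeasN u : bmeas u -> bmeas (fun x => - u x).
Proof.
move=> bu; apply: (bmeas_eq _ (bmeasM (bmeas_cst (-1)) bu)) => x _ /=.
by rewrite mulN1r.
Qed.

Lemma bmeasB u v : bmeas u -> bmeas v -> bmeas (fun x => u x - v x).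
Proof. by move=> bu bv; apply: bmeasD => //; exact: bmeasN. Qed.

Lemma bmeas_cont (f : R -> R) u M : continuous f -> (forall x, `|f x| <= M) ->
  bmeas u -> bmeas (fun x => f (u x)).
Proof.
move=> cf fM [mu_ _]; split; last by exists M => x _.
by apply: measurableT_comp => //; exact: continuous_measurable_fun.
Qed.

Lemma bmeas_sin u : bmeas u -> bmeas (fun x => sin (u x)).
Proof. by apply: (bmeas_cont _ (@sin_max R)) => x; exact: continuous_sin. Qed.

Lemma bmeas_cos u : bmeas u -> bmeas (fun x => cos (u x)).
Proof. by apply: (bmeas_cont _ (@cos_max R)) => x; exact: continuous_cos. Qed.

Lemma integD g h : integ g -> integ h -> integ (fun x => g x + h x).
Proof. by move=> ig ih; exact: (integrableD _ ig ih). Qed.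

Lemma integM g u : integ g -> bmeas u -> integ (fun x => g x * u x).
Proof.
move=> ig [mu_ [M uM]]; apply: (@integrableMl _ _ _ mu _ _ _ u ig) => //.
exists M; split; first exact: num_real.
move=> y My x; rewrite /= => xT.
by apply: le_trans (ltW My); exact: uM.
Qed.

Lemma integ_bmeas u : bmeas u -> integ u.
Proof.
move=> [mu_ [M uM]]; apply: measurable_bounded_integrable => //=.
  by rewrite lebesgue_measure_itv /=; case: ifP => _; rewrite ?ltry.
exists M; split; first exact: num_real.
move=> y My x; rewrite /= => xT.
by apply: le_trans (ltW My); exact: uM.
Qed.

Lemma bmeas_norm u : bmeas u -> bmeas (fun x => `|u x|).
Proof.
move=> [mu_ [M uM]]; split; first exact: measurableT_comp.
by exists M => x /uM; rewrite normr_id.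
Qed.

Lemma integ_sqr u : bmeas u -> integ (fun x => u x ^+ 2).
Proof.
by move=> bu; apply: (integ_eq _ (integ_bmeas (bmeasM bu bu))) => x _; rewrite expr2.
Qed.

Lemma measurable_integ g : integ g -> measurable_fun `[0, T] g.
Proof. by move=> /measurable_int /measurable_EFinP. Qed.

Lemma integZ c g : integ g -> integ (fun x => c * g x).
Proof.
move=> ig; apply: (integ_eq _ (integM ig (bmeas_cst c))) => x _ /=.
by rewrite mulrC.
Qed.

Lemma integN g : integ g -> integ (fun x => - g x).
Proof. by move=> ig; apply: (integ_eq _ (integZ (-1) ig)) => x _; rewrite mulN1r. Qed.

Lemma integB g h : integ g -> integ h -> integ (fun x => g x - h x).
Proof. by move=> ig ih; apply: integD => //; exact: integN. Qed.

Lemma integ_norm g : integ g -> integ (fun x => `|g x|).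
Proof. by move=> ig; exact: (integrable_norm ig). Qed.

Lemma integ_sum (I : Type) (s : seq I) (g : I -> R -> R) :
  (forall i, integ (g i)) -> integ (fun x => \sum_(i <- s) g i x).
Proof.
move=> ig; elim: s => [|i s IH].
  apply: (integ_eq _ (integ_bmeas (bmeas_cst 0))) => x _.
  by rewrite big_nil.
apply: (integ_eq _ (integD (ig i) IH)) => x _.
by rewrite big_cons.
Qed.

Lemma in_itvS (x : R) : x \in `[0, T] -> `[0, x] `<=` `[0, T].
Proof.
rewrite in_itv/= => /andP[_ xT] t /=; rewrite !in_itv/= => /andP[-> tx] /=.
exact: le_trans xT.
Qed.

Lemma integ_sub g x : integ g -> x \in `[0, T] ->
  mu.-integrable `[0, x] (EFin \o g).
Proof. by move=> ig xT; apply: integrableS ig => //; exact: in_itvS. Qed.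

Lemma eq_prim g h x : x \in `[0, T] -> {in `[0, T], g =1 h} ->
  prim g x = prim h x.
Proof.
move=> xT gh; apply: eq_Rintegral => t; rewrite inE/= => tx.
by apply: gh; exact: in_itvS tx.
Qed.

Lemma primD g h x : x \in `[0, T] -> integ g -> integ h ->
  prim (fun t => g t + h t) x = prim g x + prim h x.
Proof. by move=> xT ig ih; rewrite /prim RintegralD//; exact: integ_sub. Qed.

Lemma primB g h x : x \in `[0, T] -> integ g -> integ h ->
  prim (fun t => g t - h t) x = prim g x - prim h x.
Proof. by move=> xT ig ih; rewrite /prim RintegralB//; exact: integ_sub. Qed.

Lemma primZ c g x : x \in `[0, T] -> integ g ->
  prim (fun t => c * g t) x = c * prim g x.
Proof. by move=> xT ig; rewrite /prim RintegralZl//; exact: integ_sub. Qed.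

Lemma prim0 g : prim g 0 = 0.
Proof. by rewrite /prim set_itv1 Rintegral_set1. Qed.

Lemma prim_cst c x : 0 <= x -> prim (cst c) x = c * x.
Proof.
move=> x0; rewrite /prim Rintegral_cst//= lebesgue_measure_itv/= lte_fin.
case: ltP => [_|x0']; first by rewrite -EFinD /= subr0.
by have -> : x = 0 by [apply/eqP; rewrite eq_le x0 x0'|].
Qed.

Lemma prim_sum (I : Type) (s : seq I) (g : I -> R -> R) x : x \in `[0, T] ->
  (forall i, integ (g i)) ->
  prim (fun t => \sum_(i <- s) g i t) x = \sum_(i <- s) prim (g i) x.
Proof.
move=> xT ig; elim: s => [|i s IH].
  rewrite big_nil (_ : (fun t => _) = cst 0).
    by rewrite prim_cst ?mul0r//; move: xT; rewrite in_itv/= => /andP[].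
  by apply/funext => t; rewrite big_nil.
rewrite big_cons -IH -primD//; last exact: integ_sum.
by apply: eq_prim => // t _; rewrite big_cons.
Qed.

Lemma le_prim g h x : x \in `[0, T] -> integ g -> integ h ->
  (forall t, t \in `[0, T] -> g t <= h t) -> prim g x <= prim h x.
Proof.
move=> xT ig ih gh; apply: le_Rintegral => //.
- exact: integ_sub.
- exact: integ_sub.
- by move=> t /= tx; apply: gh; exact: in_itvS tx.
Qed.

Lemma prim_norm g x : x \in `[0, T] -> integ g ->
  `|prim g x| <= prim (fun t => `|g t|) x.
Proof. by move=> xT ig; apply: le_normr_Rintegral => //; exact: integ_sub. Qed.

Lemma prim_ge0 g x : x \in `[0, T] -> (forall t, t \in `[0, T] -> 0 <= g t) ->
  0 <= prim g x.
Proof.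
move=> xT g0; apply: Rintegral_ge0 => t /= tx.
by apply: g0; exact: in_itvS tx.
Qed.

Lemma prim_split g a b : 0 <= a -> a <= b -> b <= T -> integ g ->
  prim g b = prim g a + \int[mu]_(t in `]a, b]) g t.
Proof.
move=> a0 ab bT ig; rewrite /prim.
rewrite -Rintegral_setU//=.
- congr Rintegral; apply/seteqP; split=> t /=; rewrite !in_itv/=; lra.
- apply: (integrableS _ _ _ ig) => //; first exact: measurableU.
  by move=> t [] /=; rewrite !in_itv/=; lra.
- by apply/disj_set2P; rewrite -subset0 => t [] /=; rewrite !in_itv/=; lra.
Qed.

(** Only the bound on ]a, b] matters: this is what lets increments of a
    primitive be compared with a bound that depends on a. *)
Lemma le_prim_incr g h a b : 0 <= a -> a <= b -> b <= T -> integ g -> integ h ->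
  (forall t, a < t -> t <= b -> `|g t| <= h t) ->
  `|prim g b - prim g a| <= prim h b - prim h a.
Proof.
move=> a0 ab bT ig ih gh.
rewrite (prim_split a0 ab bT ig) (prim_split a0 ab bT ih) ![_ a + _]addrC !addrK.
have s : `]a, b] `<=` `[0, T].
  by move=> t /=; rewrite !in_itv/= => /andP[? ?]; apply/andP; split; lra.
have igs : mu.-integrable `]a, b] (EFin \o g) by apply: integrableS ig.
have ihs : mu.-integrable `]a, b] (EFin \o h) by apply: integrableS ih.
apply: le_trans (le_normr_Rintegral _ igs) _ => //.
apply: le_Rintegral => //; first exact: (integrable_norm igs).
by move=> t /=; rewrite in_itv/= => /andP[? ?]; exact: gh.
Qed.

Lemma prim_mono g a b : 0 <= a -> a <= b -> b <= T -> integ g ->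
  (forall t, t \in `[0, T] -> 0 <= g t) -> prim g a <= prim g b.
Proof.
move=> a0 ab bT ig g0; rewrite -subr_ge0.
apply: le_trans (le_prim_incr a0 ab bT ig ig _) => // t at_ tb.
by rewrite ger0_norm// g0// in_itv/=; lra.
Qed.

Lemma prim_continuous g : 0 <= T -> integ g -> {within `[0, T], continuous (prim g)}.
Proof. by move=> T0 ig; exact: parameterized_integral_continuous. Qed.

Lemma bmeas_prim g : 0 <= T -> integ g -> bmeas (prim g).
Proof.
move=> T0 ig; split.
  by apply: subspace_continuous_measurable_fun => //; exact: prim_continuous.
exists (prim (fun t => `|g t|) T) => x xT.
apply: le_trans (prim_norm xT ig) _.
move: xT; rewrite in_itv/= => /andP[x0 xT].
apply: prim_mono => //; exact: integ_norm.
Qed.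

(** The identity u / v = u v (v^2)^-1 holds also where v vanishes, and the
    inverse of a nonnegative function is measurable as a real power. *)
Lemma bmeas_div u v M : bmeas u -> bmeas v -> 0 <= M ->
  (forall x, x \in `[0, T] -> `|u x| <= M * `|v x|) -> bmeas (fun x => u x / v x).
Proof.
move=> bu bv M0 uv; have bw := bmeasM bv bv; split.
  rewrite (_ : (fun x => _) = fun x => u x * (v x * (v x * v x) `^ (-1))).
    have [mu_ _] := bu; have [mv _] := bv; have [mw _] := bw.
    apply: measurable_funM => //; apply: measurable_funM => //.
    by apply: (measurableT_comp (f := @powR R ^~ (-1))) => //; exact: measurable_powR.
  apply/funext => x; rewrite powR_inv1 -?expr2 ?sqr_ge0//.
  have [->|v0] := eqVneq (v x) 0; first by rewrite mul0r invr0.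
  by field.
exists M => x xT; rewrite normrM normfV.
have [->|v0] := eqVneq (v x) 0; first by rewrite normr0 invr0 mulr0.
by rewrite ler_pdivrMr ?normr_gt0// uv.
Qed.

(** The quadratic polynomial in s given by the integral of (u - s g)^2 is
    nonnegative, so its discriminant is not positive. *)
Lemma cauchy_schwarz u g x : x \in `[0, T] -> bmeas u -> integ g ->
  integ (fun t => g t ^+ 2) ->
  prim (fun t => u t * g t) x ^+ 2 <=
    prim (fun t => g t ^+ 2) x * prim (fun t => u t ^+ 2) x.
Proof.
move=> xpi bu ig ig2; set X := prim (fun t => u t * g t) x.
set W := prim (fun t => g t ^+ 2) x; set D := prim (fun t => u t ^+ 2) x.
have iug : integ (fun t => u t * g t).
  by apply: (integ_eq _ (integM ig bu)) => t _; rewrite mulrC.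
have iu2 := integ_sqr bu.
have quad s : 0 <= D - 2 * s * X + s ^+ 2 * W.
  rewrite /D /X /W -!(primZ _ xpi)// -(primB xpi)//; last exact: integZ.
  rewrite -(primD xpi); [|by apply: integB => //; exact: integZ|exact: integZ].
  apply: (prim_ge0 xpi) => t _.
  by have := sqr_ge0 (u t - s * g t); congr (_ <= _); ring.
have W0 : 0 <= W by apply: (prim_ge0 xpi) => t _; exact: sqr_ge0.
have D0 : 0 <= D by apply: (prim_ge0 xpi) => t _; exact: sqr_ge0.
have [W0'|W1] := eqVneq W 0.
  have [->|X0] := eqVneq X 0; first by rewrite expr0n mulr_ge0.
  have := quad ((D + 1) / (2 * X)); rewrite W0' mulr0 addr0.
  have -> : 2 * ((D + 1) / (2 * X)) * X = D + 1 by field.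
  by lra.
have Wp : 0 < W by rewrite lt_neqAle eq_sym W1.
have := quad (X / W); rewrite -(pmulr_rge0 _ Wp).
have -> : W * (D - 2 * (X / W) * X + (X / W) ^+ 2 * W) = W * D - X ^+ 2.
  by field.
by rewrite subr_ge0.
Qed.

Lemma sqr_prim_le u x : x \in `[0, T] -> bmeas u ->
  prim u x ^+ 2 <= x * prim (fun t => u t ^+ 2) x.
Proof.
move=> xpi bu; have x0 : 0 <= x by move: xpi; rewrite in_itv/= => /andP[].
have i1 : integ (cst 1 : R -> R) := integ_bmeas (bmeas_cst 1).
have e1 : (fun t => cst 1 t ^+ 2) = cst 1 :> (R -> R).
  by apply/funext => t; rewrite /cst expr1n.
have e2 : (fun t => u t * cst 1 t) = u by apply/funext => t; rewrite /cst mulr1.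
have := cauchy_schwarz xpi bu i1.
by rewrite e1 e2 prim_cst// mul1r; apply.
Qed.

End Integral.
Arguments prim {R}.

(** * Absolutely continuous functions *)

Section AbsolutelyContinuous.
Context {R : realType} (T : R).
Hypothesis T0 : 0 <= T.
Implicit Types (g h u v w : R -> R) (a b c x t : R).

Local Notation integ := (integ T).
Local Notation bmeas := (bmeas T).

(** Absolute continuity is recorded together with one integrable density [u'],
    which is not unique: it need not be the derivative of [u] at every point. *)
Definition ac u u' : Prop :=
  integ u' /\ forall x, x \in `[0, T] -> u x = u 0 + prim u' x.

(** By the intermediate value theorem [a, b] can be cut where [H] has done half
    of its increase.  Each half contributes a quarter of the bound, so the
    bound on the increment of [W] is halved by every subdivision. *)
Lemma quadratic_increments_constant (W H : R -> R) (C : R) :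
  {within `[0, T], continuous H} ->
  (forall a b, 0 <= a -> a <= b -> b <= T -> H a <= H b) ->
  (forall a b, 0 <= a -> a <= b -> b <= T ->
     `|W b - W a| <= C * (H b - H a) ^+ 2) ->
  forall x, x \in `[0, T] -> W x = W 0.
Proof.
move=> cH mH qW.
have half n : forall a b, 0 <= a -> a <= b -> b <= T ->
    `|W b - W a| * 2 ^+ n <= C * (H b - H a) ^+ 2.
  elim: n => [|n IH] a b a0 ab bT; first by rewrite mulr1 qW.
  have Hab := mH a b a0 ab bT.
  have [||c cab Hc] := @IVT R H a b ((H a + H b) / 2) ab.
  - apply: continuous_subspaceW cH => t /=.
    by rewrite !in_itv/= => /andP[? ?]; apply/andP; split; lra.
  - by rewrite min_l// max_r//; lra.
  move: cab; rewrite in_itv/= => /andP[ac_ cb].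
  have := IH a c a0 ac_ ltac:(lra).
  have := IH c b ltac:(lra) cb bT.
  have -> : H b - H c = (H b - H a) / 2 by rewrite Hc; field.
  have -> : H c - H a = (H b - H a) / 2 by rewrite Hc; field.
  have tri : `|W b - W a| <= `|W b - W c| + `|W c - W a|.
    have -> : W b - W a = (W b - W c) + (W c - W a) by ring.
    exact: ler_normD.
  have p2 : 0 <= 2 ^+ n :> R by exact: exprn_ge0.
  have := ler_wpM2r p2 tri.
  by rewrite [2 ^+ n.+1]exprS; lra.
move=> x; rewrite in_itv/= => /andP[x0 xT].
apply/eqP; rewrite -subr_eq0 -normr_le0 leNgt; apply/negP => Wx.
set K := C * (H x - H 0) ^+ 2.
(* otherwise 2 ^ n would stay below the fixed number K / |W x - W 0| *)
have [n Kn] : exists n : nat, K / `|W x - W 0| < n%:R.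
  exists (Num.bound (K / `|W x - W 0|)).
  apply: archi_boundP; rewrite divr_ge0//.
  by apply: le_trans (qW 0 x (lexx 0) x0 xT).
have nn : (n%:R : R) <= 2 ^+ n by rewrite -natrX ler_nat ltnW// ltn_expl.
have := half n 0 x (lexx 0) x0 xT; rewrite leNgt => /negP; apply.
by rewrite -/K -ltr_pdivrMl// mulrC; exact: lt_le_trans nn.
Qed.

Lemma ac_eq u u' w w' : ac u u' ->
  (forall x, x \in `[0, T] -> u x = w x) ->
  (forall x, x \in `[0, T] -> u' x = w' x) -> ac w w'.
Proof.
move=> [iu uE] uw uw'; split; first exact: integ_eq iu.
move=> x xT; have T0' : 0 \in `[0, T] by move: xT; rewrite !in_itv/=; lra.
rewrite -uw// uE// -uw//.
by congr (_ + _); exact: eq_prim uw'.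
Qed.

Lemma ac_integ u u' : ac u u' -> integ u'. Proof. by case. Qed.

Lemma ac_prim g : integ g -> ac (prim g) g.
Proof. by move=> ig; split=> // x xT; rewrite prim0 add0r. Qed.

Lemma ac_cst c : ac (cst c) (cst 0).
Proof.
split; first exact/integ_bmeas/bmeas_cst.
by move=> x; rewrite in_itv/= => /andP[x0 _]; rewrite prim_cst// mul0r addr0.
Qed.

Lemma ac_id : ac id (cst 1).
Proof.
split; first exact/integ_bmeas/bmeas_cst.
by move=> x; rewrite in_itv/= => /andP[x0 _]; rewrite prim_cst// mul1r add0r.
Qed.

Lemma acD u u' v v' : ac u u' -> ac v v' ->
  ac (fun x => u x + v x) (fun x => u' x + v' x).
Proof.
move=> [iu uE] [iv vE]; split; first exact: integD.
by move=> x xT; rewrite (uE _ xT) (vE _ xT) (primD xT)//; ring.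
Qed.

Lemma acZ c u u' : ac u u' -> ac (fun x => c * u x) (fun x => c * u' x).
Proof.
move=> [iu uE]; split; first exact: integZ.
by move=> x xT; rewrite (uE _ xT) (primZ _ xT)//; ring.
Qed.

Lemma acN u u' : ac u u' -> ac (fun x => - u x) (fun x => - u' x).
Proof.
move=> au; apply: (ac_eq (acZ (-1) au)) => x _; ring.
Qed.

Lemma acB u u' v v' : ac u u' -> ac v v' ->
  ac (fun x => u x - v x) (fun x => u' x - v' x).
Proof. by move=> au av; apply: acD => //; exact: acN. Qed.

Lemma ac_bmeas u u' : ac u u' -> bmeas u.
Proof.
move=> [iu uE]; apply: (bmeas_eq _ (bmeasD (bmeas_cst T (u 0)) (bmeas_prim T0 iu))).
by move=> x xT; rewrite (uE _ xT).
Qed.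

Lemma ac_incr u u' a b : ac u u' -> 0 <= a -> a <= b -> b <= T ->
  u b - u a = prim u' b - prim u' a.
Proof.
move=> [iu uE] a0 ab bT; rewrite (uE b) ?(uE a)//; first ring.
all: rewrite in_itv/=; lra.
Qed.

Lemma ac_homo u u' a b : ac u u' -> (forall x, x \in `[0, T] -> 0 <= u' x) ->
  0 <= a -> a <= b -> b <= T -> u a <= u b.
Proof.
move=> au u0 a0 ab bT; rewrite -subr_ge0 (ac_incr au)// subr_ge0.
by apply: (@prim_mono _ T) => //; exact: ac_integ au.
Qed.

Lemma ac_constant u u' x : ac u u' -> {in `[0, T], forall t, u' t = 0} ->
  x \in `[0, T] -> u x = u 0.
Proof.
move=> au u0 xT; have [_ E] : ac u (cst 0) by apply: ac_eq au _ _.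
rewrite E// prim_cst ?mul0r ?addr0//.
by move: xT; rewrite in_itv/= => /andP[].
Qed.

Lemma itv0 : 0 \in `[0, T]. Proof. by rewrite in_itv/= lexx. Qed.

(** The increment of F(u) minus the integral of F'(u) u' is at most quadratic
    in the increment of the primitive of |u'|, so that
    [quadratic_increments_constant] applies.  The Taylor estimate is asked on
    the range of [u] only, since the exponential satisfies none on the line. *)
Lemma ac_comp (F F' : R -> R) (K C : R) u u' : 0 <= C -> continuous F' ->
  (forall a b, `|a| <= K -> `|b| <= K ->
     `|F b - F a - F' a * (b - a)| <= C * (b - a) ^+ 2) ->
  (forall x, x \in `[0, T] -> `|u x| <= K) -> ac u u' ->
  ac (fun x => F (u x)) (fun x => F' (u x) * u' x).
Proof.
move=> C0 cF' FC uK au; have [iu uE] := au.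
(* the sum of the Taylor estimates at a and at b makes F' Lipschitz *)
have lipF' a b : `|a| <= K -> `|b| <= K -> `|F' b - F' a| <= C * 2 * `|b - a|.
  move=> aK bK; have [->|ba] := eqVneq b a; first by rewrite !subrr normr0 mulr0.
  have ba0 : 0 < `|b - a| by rewrite normr_gt0 subr_eq0.
  rewrite -(ler_pM2r ba0) -normrM.
  have -> : (F' b - F' a) * (b - a) =
    (F b - F a - F' a * (b - a)) + (F a - F b - F' b * (a - b)) by ring.
  apply: le_trans (ler_normD _ _) _.
  apply: le_trans (lerD (FC _ _ aK bK) (FC _ _ bK aK)) _.
  have -> : C * 2 * `|b - a| * `|b - a| = C * 2 * `|b - a| ^+ 2 by ring.
  by rewrite real_normK ?num_real//; lra.
have K0 : 0 <= K by apply: le_trans (uK 0 itv0) => //.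
have bF : bmeas (fun x => F' (u x)).
  split.
    apply: (measurableT_comp (f := F')); first exact: continuous_measurable_fun.
    by have [] := ac_bmeas au.
  exists (`|F' 0| + C * 2 * K) => x xT.
  have -> : F' (u x) = F' 0 + (F' (u x) - F' 0) by ring.
  apply: le_trans (ler_normD _ _) _; rewrite lerD2l.
  have := lipF' 0 (u x); rewrite normr0 subr0 => /(_ K0 (uK x xT)) h.
  by apply: le_trans h _; rewrite ler_wpM2l ?mulr_ge0// uK.
have iFu : integ (fun x => F' (u x) * u' x).
  by apply: (integ_eq _ (integM iu bF)) => x _; rewrite mulrC.
split=> // x xT.
pose H := prim (fun t => `|u' t|).
have Hle a b : 0 <= a -> a <= b -> b <= T -> `|u b - u a| <= H b - H a.
  move=> a0 ab bT; rewrite (ac_incr au)//.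
  by apply: (@le_prim_incr _ T) => //; exact: integ_norm.
have mH a b : 0 <= a -> a <= b -> b <= T -> H a <= H b.
  by move=> a0 ab bT; apply: (@prim_mono _ T) => //; exact: integ_norm.
pose W x := F (u x) - prim (fun t => F' (u t) * u' t) x.
suff : W x = W 0 by rewrite /W prim0 subr0 => /eqP; rewrite subr_eq => /eqP.
apply: (@quadratic_increments_constant W H (C + C * 2)) xT => //.
  by apply: prim_continuous => //; exact: integ_norm.
move=> a b a0 ab bT.
have aT : a \in `[0, T] by rewrite in_itv/=; lra.
have bT' : b \in `[0, T] by rewrite in_itv/=; lra.
pose k t := F' (u t) * u' t - F' (u a) * u' t.
have kE c : c \in `[0, T] ->
    prim k c = prim (fun t => F' (u t) * u' t) c - F' (u a) * prim u' c.
  by move=> cT; rewrite (primB cT)// ?(primZ _ cT)//; exact: integZ.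
have ik : integ k by apply: integB => //; exact: integZ.
have -> : W b - W a = (F (u b) - F (u a) - F' (u a) * (u b - u a)) -
    (prim k b - prim k a).
  by rewrite !kE// /W [in RHS](ac_incr au)//; ring.
apply: le_trans (ler_normB _ _) _; rewrite mulrDl; apply: lerD.
  apply: le_trans (FC _ _ (uK a aT) (uK b bT')) _.
  apply: ler_wpM2l => //; rewrite -[leLHS]real_normK ?num_real//.
  by rewrite ler_sqr ?nnegrE ?Hle// subr_ge0 mH.
have -> : C * 2 * (H b - H a) ^+ 2 = C * 2 * (H b - H a) * H b -
  C * 2 * (H b - H a) * H a by ring.
rewrite {2 4}/H -(primZ _ aT (integ_norm iu)) -(primZ _ bT' (integ_norm iu)).
apply: (@le_prim_incr _ T) => //; first exact/integZ/integ_norm.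
move=> t at_ tb; have tT : t \in `[0, T] by rewrite in_itv/=; lra.
rewrite /k -mulrBl normrM ler_wpM2r//.
apply: le_trans (lipF' _ _ (uK a aT) (uK t tT)) _.
rewrite ler_wpM2l ?mulr_ge0//; apply: le_trans (Hle a t _ _ _) _ => //; try lra.
by rewrite lerD2r mH; lra.
Qed.

End AbsolutelyContinuous.

Section ChainRules.
Context {R : realType} (T : R).
Hypothesis T0 : 0 <= T.
Implicit Types (u v w : R -> R) (a b c x t : R).

Local Notation ac := (ac T).
Local Notation integ := (integ T).
Local Notation bmeas := (bmeas T).

(** The bounds on c are stated so that they do not depend on which of a and b is
    the larger. *)
Lemma mean_value (F F' : R -> R) a b : (forall x, is_derive x 1 F (F' x)) ->
  exists c, [/\ F b - F a = F' c * (b - a), `|c - a| <= `|b - a|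
    & forall K, `|a| <= K -> `|b| <= K -> `|c| <= K].
Proof.
move=> dF.
have cF x y : {within `[x, y], continuous F}.
  apply: continuous_subspaceT => z; apply: differentiable_continuous.
  by apply/derivable1_diffP; have [] := dF z.
have [ab|ba] := leP a b.
  have [c] := MVT_segment ab (fun x _ => dF x) (cF a b).
  rewrite in_itv/= => /andP[ac_ cb] E; exists c; split=> //.
    by rewrite !ger0_norm; lra.
  by move=> K; rewrite !ler_norml; lra.
have [c] := MVT_segment (ltW ba) (fun x _ => dF x) (cF b a).
rewrite in_itv/= => /andP[bc ca] E; exists c; split=> //.
- by rewrite -opprB E; ring.
- by rewrite !ler0_norm; lra.
- by move=> K; rewrite !ler_norml; lra.
Qed.

Lemma taylor1 (F F' F'' : R -> R) (K C : R) :
  (forall x, is_derive x 1 F (F' x)) -> (forall x, is_derive x 1 F' (F'' x)) ->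
  (forall x, `|x| <= K -> `|F'' x| <= C) ->
  forall a b, `|a| <= K -> `|b| <= K ->
    `|F b - F a - F' a * (b - a)| <= C * (b - a) ^+ 2.
Proof.
move=> dF dF' FC a b aK bK.
have [c [-> ca /(_ K aK bK) cK]] := mean_value a b dF.
have [d [E _ /(_ K aK cK) dK]] := mean_value a c dF'.
rewrite -mulrBl E !normrM -[_ ^+ 2]real_normK ?num_real// expr2 mulrA.
rewrite ler_wpM2r// ler_pM// ?FC//.
Qed.

Lemma ac_sin u u' : ac u u' -> ac (fun x => sin (u x)) (fun x => cos (u x) * u' x).
Proof.
move=> au; have [_ [K uK]] := ac_bmeas T0 au.
apply: (ac_comp T0 (F' := cos) (K := K) (C := 1)) au => //.
  exact: continuous_cos.
apply: (@taylor1 sin cos (fun x => - sin x)) => x _.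
by rewrite normrN sin_max.
Qed.

Lemma ac_cos u u' : ac u u' ->
  ac (fun x => cos (u x)) (fun x => - sin (u x) * u' x).
Proof.
move=> au; have [_ [K uK]] := ac_bmeas T0 au.
apply: (ac_comp T0 (F' := fun x => - sin x) (K := K) (C := 1)) au => //.
  by move=> x; apply: continuousN; exact: continuous_sin.
apply: (@taylor1 cos (fun x => - sin x) (fun x => - cos x)) => x _.
by rewrite normrN cos_max.
Qed.

Lemma ac_expR u u' : ac u u' ->
  ac (fun x => expR (u x)) (fun x => expR (u x) * u' x).
Proof.
move=> au; have [_ [K uK]] := ac_bmeas T0 au.
apply: (ac_comp T0 (F' := expR) (K := K) (C := expR K)) au => //.
  exact: continuous_expR.
apply: (@taylor1 expR expR expR) => // x xK.
by rewrite ger0_norm ?expR_ge0// ler_expR; apply: le_trans xK; exact: ler_norm.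
Qed.

Lemma ac_sqr u u' : ac u u' -> ac (fun x => u x ^+ 2) (fun x => 2 * u x * u' x).
Proof.
move=> au; have [_ [K uK]] := ac_bmeas T0 au.
apply: (ac_comp T0 (F := fun x => x ^+ 2) (F' := fun x =>
  2 * x) (K := K) (C := 1)) au => //.
  exact: mulrl_continuous.
move=> a b _ _; rewrite le_eqVlt; apply/orP; left; apply/eqP.
rewrite mul1r -[RHS]ger0_norm ?sqr_ge0//; congr `|_|; ring.
Qed.

(** Polarization of the chain rule for the square. *)
Lemma acM u u' v v' : ac u u' -> ac v v' ->
  ac (fun x => u x * v x) (fun x => u' x * v x + u x * v' x).
Proof.
move=> au av.
apply: (ac_eq (acZ 4^-1 (acB (ac_sqr (acD au av)) (ac_sqr (acB au av))))).
  by move=> x _; field.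
by move=> x _; field.
Qed.

End ChainRules.

(** * Gronwall's inequalities *)

Section Gronwall.
Context {R : realType} (T : R).
Hypothesis T0 : 0 <= T.
Implicit Types (u v w g N : R -> R) (a b c x t : R).

Local Notation ac := (ac T).
Local Notation integ := (integ T).

(** With G the primitive of g, the function k x - N exp(- G) is nondecreasing. *)
Lemma gronwall_upper N N' g k : ac N N' -> integ g ->
  (forall x, x \in `[0, T] -> 0 <= g x) -> 0 <= k -> 0 <= N 0 ->
  (forall x, x \in `[0, T] -> N' x <= g x * N x + k) ->
  forall x, x \in `[0, T] -> N x <= (N 0 + k * T) * expR (prim g T).
Proof.
move=> aN ig g0 k0 N0 Ng x xT.
have aE := ac_expR T0 (acN (ac_prim ig)).
have aW := acB (acZ k (ac_id T)) (acM T0 aN aE).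
have G0 y : y \in `[0, T] -> 0 <= prim g y by move=> yT; exact: prim_ge0 yT g0.
move: (xT); rewrite in_itv/= => /andP[x0 xT'].
have := @ac_homo _ _ _ _ 0 x aW.
rewrite prim0 oppr0 expR0 => H.
have {H} : N x * expR (- prim g x) <= N 0 + k * x.
  suff : k * 0 - N 0 * 1 <= k * x - N x * expR (- prim g x) by lra.
  apply: H => // y yT.
  have -> : k * 1 - (N' y * expR (- prim g y) +
      N y * (expR (- prim g y) * - g y)) =
    k - expR (- prim g y) * (N' y - g y * N y) by ring.
  have e0 := expR_ge0 (- prim g y).
  have e1 : expR (- prim g y) <= 1 by rewrite expR_le1 oppr_le0 G0.
  have := Ng y yT; move: (expR _) e0 e1 => e e0 e1 H.
  have : e * (N' y - g y * N y) <= e * k by apply: ler_wpM2l => //; lra.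
  have : e * k <= 1 * k by apply: ler_wpM2r.
  by lra.
rewrite expRN ler_pdivrMr ?expR_gt0// => H; apply: le_trans H _.
apply: ler_pM; rewrite ?expR_ge0//; first by rewrite addr_ge0// mulr_ge0.
  by rewrite lerD2l ler_wpM2l.
by rewrite ler_expR; apply: (@prim_mono _ T).
Qed.

(** With G the primitive of g, the function N exp(G) is nondecreasing. *)
Lemma gronwall_lower N N' g : ac N N' -> integ g ->
  (forall x, x \in `[0, T] -> 0 <= g x) -> 0 <= N 0 ->
  (forall x, x \in `[0, T] -> - (g x * N x) <= N' x) ->
  forall x, x \in `[0, T] -> N 0 * expR (- prim g T) <= N x.
Proof.
move=> aN ig g0 N0 Ng x xT.
have aW := acM T0 aN (ac_expR T0 (ac_prim ig)).
move: (xT); rewrite in_itv/= => /andP[x0 xT'].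
have := @ac_homo _ _ _ _ 0 x aW.
rewrite prim0 expR0 mulr1 => H.
have {H} : N 0 <= N x * expR (prim g x).
  apply: H => // y yT.
  have -> : N' y * expR (prim g y) + N y * (expR (prim g y) * g y) =
     (N' y + g y * N y) * expR (prim g y) by ring.
  by rewrite mulr_ge0 ?expR_ge0//; have := Ng y yT; lra.
rewrite -ler_pdivrMr ?expR_gt0// -expRN => H; apply: le_trans H.
apply: ler_wpM2l => //; rewrite ler_expR lerN2.
exact: (@prim_mono _ T).
Qed.

End Gronwall.

(** * The Dirac system in real components *)

Section DiracSystem.
Context {R : realType} (T : R).
Hypothesis T0 : 0 <= T.
Variables p q : R -> R.
Hypotheses (ip : integ T p) (iq : integ T q).
Implicit Types (u v y : R -> R) (a b c x t : R).

Local Notation ac := (ac T).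
Local Notation integ := (integ T).

(** The system B y' + Omega y = (a + i b) y solved for y', where the components
    of y are u1 + i v1 and u2 + i v2. *)
Definition dirac a b u1 v1 u2 v2 : Prop :=
  [/\ ac u1 (fun x => - (a * u2 x - b * v2 x) + q x * u1 x - p x * u2 x),
      ac v1 (fun x => - (a * v2 x + b * u2 x) + q x * v1 x - p x * v2 x),
      ac u2 (fun x => (a * u1 x - b * v1 x) - p x * u1 x - q x * u2 x) &
      ac v2 (fun x => (a * v1 x + b * u1 x) - p x * v1 x - q x * v2 x)].

Definition energy u1 v1 u2 v2 x : R :=
  u1 x ^+ 2 + v1 x ^+ 2 + u2 x ^+ 2 + v2 x ^+ 2.

(** Bounds the logarithmic derivative of the energy.  The real part of the
    spectral parameter is absent: it only rotates the solution. *)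
Definition growth b x : R := 2 * (`|b| + `|p x| + `|q x|).

Lemma integ_growth b : integ (growth b).
Proof.
apply: integZ; apply: integD; last exact: integ_norm.
by apply: integD; [exact/integ_bmeas/bmeas_cst | exact: integ_norm].
Qed.

Lemma growth_ge0 b x : 0 <= growth b x.
Proof. by rewrite mulr_ge0// !addr_ge0. Qed.

Lemma energy_ge0 u1 v1 u2 v2 x : 0 <= energy u1 v1 u2 v2 x.
Proof. by rewrite !addr_ge0// sqr_ge0. Qed.

Lemma normM_le (r s m : R) : `|s| <= m -> `|r * s| <= `|r| * m.
Proof. by move=> sm; rewrite normrM ler_wpM2l. Qed.

(** Each of the three quadratic forms is dominated by the energy, because the
    energy plus or minus the form is a sum of squares. *)
Lemma energy_rate_le a b x u1 v1 u2 v2 :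
  `|2 * b * (2 * (u1 x * v2 x - v1 x * u2 x)) +
    2 * q x * (u1 x ^+ 2 + v1 x ^+ 2 - u2 x ^+ 2 - v2 x ^+ 2) -
    2 * p x * (2 * (u1 x * u2 x + v1 x * v2 x))|
  <= growth b x * energy u1 v1 u2 v2 x.
Proof.
rewrite /growth /energy; set N := (X in _ <= _ * X).
have -> : 2 * (`|b| + `|p x| + `|q x|) * N =
  `|2 * b| * N + `|2 * q x| * N + `|2 * p x| * N.
  by rewrite !normrM normr_nat; ring.
move: (u1 x) (v1 x) (u2 x) (v2 x) @N => r1 s1 r2 s2 N.
apply: le_trans (ler_normB _ _) _; apply: lerD.
  apply: le_trans (ler_normD _ _) _.
  apply: lerD; apply: normM_le; rewrite ler_norml; apply/andP; split.
  - rewrite -subr_ge0; have -> : 2 * (r1 * s2 - s1 * r2) - - N =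
      (r1 + s2) ^+ 2 + (s1 - r2) ^+ 2 by rewrite /N; ring.
    by rewrite addr_ge0 ?sqr_ge0.
  - rewrite -subr_ge0; have -> : N - 2 * (r1 * s2 - s1 * r2) =
      (r1 - s2) ^+ 2 + (s1 + r2) ^+ 2 by rewrite /N; ring.
    by rewrite addr_ge0 ?sqr_ge0.
  - rewrite /N; move: (sqr_ge0 r1) (sqr_ge0 s1) (sqr_ge0 r2) (sqr_ge0 s2); lra.
  - rewrite /N; move: (sqr_ge0 r1) (sqr_ge0 s1) (sqr_ge0 r2) (sqr_ge0 s2); lra.
apply: normM_le; rewrite ler_norml; apply/andP; split; rewrite -subr_ge0.
- have -> : 2 * (r1 * r2 + s1 * s2) - - N =
      (r1 + r2) ^+ 2 + (s1 + s2) ^+ 2 by rewrite /N; ring.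
  by rewrite addr_ge0 ?sqr_ge0.
- have -> : N - 2 * (r1 * r2 + s1 * s2) =
      (r1 - r2) ^+ 2 + (s1 - s2) ^+ 2 by rewrite /N; ring.
  by rewrite addr_ge0 ?sqr_ge0.
Qed.

Lemma ac_energy u1 v1 u2 v2 u1' v1' u2' v2' :
  ac u1 u1' -> ac v1 v1' -> ac u2 u2' -> ac v2 v2' ->
  ac (energy u1 v1 u2 v2) (fun x => 2 * u1 x * u1' x + 2 * v1 x * v1' x +
    2 * u2 x * u2' x + 2 * v2 x * v2' x).
Proof.
move=> *; apply: acD; last exact: ac_sqr.
by apply: acD; [apply: acD; exact: ac_sqr|exact: ac_sqr].
Qed.

Section Solution.
Variables (a b : R) (u1 v1 u2 v2 : R -> R).
Hypothesis sol : dirac a b u1 v1 u2 v2.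

Let rate x := 2 * b * (2 * (u1 x * v2 x - v1 x * u2 x)) +
    2 * q x * (u1 x ^+ 2 + v1 x ^+ 2 - u2 x ^+ 2 - v2 x ^+ 2) -
    2 * p x * (2 * (u1 x * u2 x + v1 x * v2 x)).

Let ac_rate : ac (energy u1 v1 u2 v2) rate.
Proof.
have [h1 h2 h3 h4] := sol.
by apply: (ac_eq (ac_energy h1 h2 h3 h4)) => // x _; rewrite /rate; ring.
Qed.

Lemma energy_upper x : x \in `[0, T] -> energy u1 v1 u2 v2 x <=
  energy u1 v1 u2 v2 0 * expR (prim (growth b) T).
Proof.
move=> xT.
have -> : energy u1 v1 u2 v2 0 = energy u1 v1 u2 v2 0 + 0 * T.
  by rewrite mul0r addr0.
apply: (gronwall_upper T0 ac_rate (integ_growth b)) => //.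
- by move=> t _; exact: growth_ge0.
- exact: energy_ge0.
- move=> t _; rewrite addr0; apply: le_trans (ler_norm _) _.
  exact: energy_rate_le.
Qed.

Lemma energy_lower x : x \in `[0, T] ->
  energy u1 v1 u2 v2 0 * expR (- prim (growth b) T) <= energy u1 v1 u2 v2 x.
Proof.
apply: (gronwall_lower T0 ac_rate (integ_growth b)) => //.
- by move=> t _; exact: growth_ge0.
- exact: energy_ge0.
- move=> t _; rewrite lerNl; apply: le_trans (ler_norm _) _; rewrite normrN.
  exact: energy_rate_le.
Qed.

(** Green's identity of a solution with its own conjugate, which forces the
    eigenvalues to be real. *)
Lemma dirac_im_wronskian :
  ac (fun x => v2 x * u1 x - u2 x * v1 x) (fun x => b * energy u1 v1 u2 v2 x).
Proof.
have [h1 h2 h3 h4] := sol.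
apply: (ac_eq (acB (acM T0 h4 h1) (acM T0 h3 h2))) => // x _.
by rewrite /energy; ring.
Qed.

End Solution.

(** The difference solves the system for (a, b) with a forcing term
    proportional to the change of parameter.  The forcing is absorbed by
    2 x y <= x^2 + y^2, at the price of adding 1 to the growth rate.  Equal
    parameters give uniqueness. *)
Lemma dirac_lipschitz a b u1 v1 u2 v2 a0 b0 y1 z1 y2 z2 :
  dirac a b u1 v1 u2 v2 -> dirac a0 b0 y1 z1 y2 z2 ->
  energy (u1 \- y1) (v1 \- z1) (u2 \- y2) (v2 \- z2) 0 = 0 ->
  forall x, x \in `[0, T] ->
    energy (u1 \- y1) (v1 \- z1) (u2 \- y2) (v2 \- z2) x <=
    ((a - a0) ^+ 2 + (b - b0) ^+ 2) *
      (energy y1 z1 y2 z2 0 * expR (prim (growth b0) T) * T) *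
        expR (prim (fun t => growth b t + 1) T).
Proof.
move=> sol sol0; have [h1 h2 h3 h4] := sol; have [k1 k2 k3 k4] := sol0 => E0 x xT.
set D2 := (a - a0) ^+ 2 + _; set K := energy y1 _ _ _ 0 * _.
have D20 : 0 <= D2 by rewrite addr_ge0 ?sqr_ge0.
have K0 : 0 <= K by rewrite mulr_ge0 ?expR_ge0 ?energy_ge0.
have aN := ac_energy (acB h1 k1) (acB h2 k2) (acB h3 k3) (acB h4 k4).
have := @gronwall_upper _ _ T0 _ _ (fun t => growth b t + 1) (D2 * K) aN.
rewrite E0 add0r mulrA; apply=> //.
- by apply: integD; [exact: integ_growth|exact/integ_bmeas/bmeas_cst].
- by move=> t _; rewrite addr_ge0// growth_ge0.
- by rewrite mulr_ge0.
move=> t tT; have := energy_upper sol0 tT; rewrite -/K => yK.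
have := energy_rate_le a b t (u1 \- y1) (v1 \- z1) (u2 \- y2) (v2 \- z2).
move/(le_trans (ler_norm _)) => /=.
have : D2 * energy y1 z1 y2 z2 t <= D2 * K by rewrite ler_wpM2l.
set N := energy (u1 \- y1) _ _ _ t.
(* the components of the forcing term *)
set F1 := - ((a - a0) * y2 t - (b - b0) * z2 t).
set G1 := - ((a - a0) * z2 t + (b - b0) * y2 t).
set F2 := (a - a0) * y1 t - (b - b0) * z1 t.
set G2 := (a - a0) * z1 t + (b - b0) * y1 t.
have : 0 <= (u1 t - y1 t - F1) ^+ 2 + (v1 t - z1 t - G1) ^+ 2 +
  (u2 t - y2 t - F2) ^+ 2 + (v2 t - z2 t - G2) ^+ 2.
  by rewrite !addr_ge0 ?sqr_ge0.
have -> : (u1 t - y1 t - F1) ^+ 2 + (v1 t - z1 t - G1) ^+ 2 +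
  (u2 t - y2 t - F2) ^+ 2 + (v2 t - z2 t - G2) ^+ 2 =
  N + D2 * energy y1 z1 y2 z2 t - 2 * ((u1 t - y1 t) * F1 + (v1 t - z1 t) * G1 +
     (u2 t - y2 t) * F2 + (v2 t - z2 t) * G2).
  by rewrite /N /D2 /energy /F1 /F2 /G1 /G2 /=; ring.
rewrite /F1 /F2 /G1 /G2.
move=> A1 A2 A3.
set L := (X in X <= _); set Q := (X in X <= _) in A3.
have -> : L = Q + 2 * ((u1 t - y1 t) * F1 + (v1 t - z1 t) * G1 +
     (u2 t - y2 t) * F2 + (v2 t - z2 t) * G2).
  by rewrite /L /Q /F1 /F2 /G1 /G2; ring.
by rewrite mulrDl mul1r; move: A1 A2 A3; rewrite -/F1 -/F2 -/G1 -/G2; lra.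
Qed.

(** Green's identity against a real solution, without conjugation: the two
    densities are the real and the imaginary part of the difference of the
    spectral parameters times the bilinear product of the solutions. *)
Lemma dirac_bilinear_wronskian a b u1 v1 u2 v2 c y1 y2 :
  dirac a b u1 v1 u2 v2 -> dirac c 0 y1 (cst 0) y2 (cst 0) ->
  ac (fun x => u2 x * y1 x - u1 x * y2 x)
     (fun x => (a - c) * (u1 x * y1 x + u2 x * y2 x) -
               b * (v1 x * y1 x + v2 x * y2 x)) /\
  ac (fun x => v2 x * y1 x - v1 x * y2 x)
     (fun x => (a - c) * (v1 x * y1 x + v2 x * y2 x) +
               b * (u1 x * y1 x + u2 x * y2 x)).
Proof.
move=> [h1 h2 h3 h4] [k1 _ k2 _]; split.
- by apply: (ac_eq (acB (acM T0 h3 k1) (acM T0 h1 k2))) => // x _ /=; ring.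
- by apply: (ac_eq (acB (acM T0 h4 k1) (acM T0 h2 k2))) => // x _ /=; ring.
Qed.

End DiracSystem.

(** * From vector solutions to real components *)

(** Allows the density of a solution to be replaced by the right-hand side of
    the differential equation, after which equations hold at every point. *)
Lemma ac_ae {R : realType} (T : R) (u u' w' : R -> R) : ac T u u' -> integ T w' ->
  {ae @lebesgue_measure R, forall x, x \in `]0, T[ -> u' x = w' x} -> ac T u w'.
Proof.
move=> [iu uE] iw uw; split=> // x xT; rewrite (uE x xT); congr (_ + _).
have oo (g : R -> R) : integ T g -> prim g x =
  \int[lebesgue_measure]_(t in `]0, x[) g t.
  move=> ig; have igx := integ_sub ig xT; rewrite /prim.
  rewrite Rintegral_itv_obnd_cbnd; last first.
    by apply: integrableS igx => //= t /=; rewrite !in_itv/= => /andP[/ltW -> /ltW].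
  rewrite Rintegral_itv_bndo_bndc//.
  by apply: integrableS igx => //= t /=; rewrite !in_itv/= => /andP[-> /ltW].
rewrite !oo// /Rintegral; congr fine.
have sub : `]0, x[ `<=` `[0, T].
  by move: xT; rewrite in_itv/= => /andP[? ?] t /=; rewrite !in_itv/=; lra.
apply: ae_eq_integral => //.
- by apply: measurable_funS (measurable_int _ iu).
- by apply: measurable_funS (measurable_int _ iw).
apply: negligibleS uw => t /=; apply: contra_not => H.
rewrite in_itv/= => tx; congr EFin; apply: H.
by move: xT; rewrite !in_itv/=; lra.
Qed.

Section SolutionComponents.
Context {R : realType}.
Local Notation mu := (@lebesgue_measure R).
Local Notation C := R[i].

(** Square integrability of the potential is only known after this
    truncation, which does not change the differential equation. *)
Definition clip (f : R -> R) : R -> R := f \_ `]0, pi[.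

Lemma integ_clip_sqr (f : R -> R) : L2_0pi f -> integ pi (fun x => clip f x ^+ 2).
Proof.
move=> /Lfun2_integrable_sqr.
by apply: integrableS => //.
Qed.

(** On a bounded interval |f| <= 1 + f^2 is integrable. *)
Lemma integ_clip (f : R -> R) : L2_0pi f -> integ pi (clip f).
Proof.
move=> f2; have i2 := integ_clip_sqr f2.
have i3 : integ pi (fun x => 1 + clip f x ^+ 2).
  by apply: integD => //; exact/integ_bmeas/bmeas_cst.
move: f2; rewrite /L2_0pi inE => /andP[]; rewrite inE/= => mf _.
apply: (le_integrable _ _ _ i3) => //.
  apply/measurable_EFinP; exact: measurable_funS mf.
move=> x _ /=; rewrite lee_fin.
rewrite [leRHS]ger0_norm ?addr_ge0 ?sqr_ge0//.
rewrite -[_ ^+ 2]real_normK ?num_real//; set t := `|clip f x|.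
have : 0 <= (t - 1) ^+ 2 + t ^+ 2 by rewrite addr_ge0 ?sqr_ge0.
have : 0 <= t by rewrite /t.
by nra.
Qed.

Lemma clipE f x : x \in `]0, pi[ -> clip f x = f x.
Proof. by move=> xpi; rewrite /clip patchE mem_set. Qed.

Definition re_part (y : R -> C) x := complex.Re (y x).
Definition im_part (y : R -> C) x := complex.Im (y x).

Lemma ac_derivative_parts (y y' : R -> C) : ac_derivative y y' ->
  ac pi (re_part y) (re_part y') /\ ac pi (im_part y) (im_part y').
Proof.
move=> [ir ii yE]; split; split=> // x /yE; rewrite /re_part /im_part => ->.
- by case: (y 0).
- by case: (y 0).
Qed.

Variables p q : R -> R.
Hypotheses (hp : L2_0pi p) (hq : L2_0pi q).

Definition dirac_sol (lam : C) (y : R -> 'cV[C]_2) : Prop :=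
  dirac pi (clip p) (clip q) (complex.Re lam) (complex.Im lam)
    (re_part (fun x => y x 0 0)) (im_part (fun x => y x 0 0))
    (re_part (fun x => y x 1 0)) (im_part (fun x => y x 1 0)).

Lemma solution_dirac (lam : C) (y : R -> 'cV[C]_2) :
  solution p q lam y -> dirac_sol lam y.
Proof.
move=> [y' [acy eqn]].
have [r1 i1] := ac_derivative_parts (acy 0).
have [r2 i2] := ac_derivative_parts (acy 1).
have ip := integ_clip hp; have iq := integ_clip hq.
have ac_bounded (u u' : R -> R) : ac pi u u' -> bmeas pi u by apply: ac_bmeas;
  exact: pi_ge0.
have integ_mul (f u u' : R -> R) : integ pi f -> ac pi u u' -> integ pi (fun x =>
  f x * u x).
  by move=> integ_f /ac_bounded; exact: integM.
have integ_lin (c d : R) (u u' v v' : R -> R) : ac pi u u' -> ac pi v v' ->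
    integ pi (fun x => c * u x + d * v x).
  by move=> /ac_bounded/integ_bmeas au /ac_bounded/integ_bmeas av; apply: integD;
    exact: integZ.
have integ_linB (c d : R) (u u' v v' : R -> R) : ac pi u u' -> ac pi v v' ->
    integ pi (fun x => c * u x - d * v x).
  by move=> /ac_bounded/integ_bmeas au /ac_bounded/integ_bmeas av; apply: integB;
    exact: integZ.
have eqn' x : x \in `]0, pi[ -> Bmx R *m y' x + Omega p q x *m y x = lam *: y x ->
   y' x 0 0 = - (lam * y x 1 0) + (clip q x)%:C * y x 0 0 - (clip p x)%:C * y x 1 0 /\
   y' x 1 0 = lam * y x 0 0 - (clip p x)%:C * y x 0 0 - (clip q x)%:C * y x 1 0.
  move=> xpi E.
  have := congr1 (fun M : 'cV[C]_2 => M 0 0) E.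
  have := congr1 (fun M : 'cV[C]_2 => M 1 0) E.
  rewrite !mxE !big_ord_recl !big_ord0 !mxE/= !addr0 !clipE//.
  have -> : lift ord0 ord0 = 1 :> 'I_2 by apply/val_inj.
  rewrite mulN1r !mul0r mul1r add0r addr0.
  move=> <- <-; split; ring.
split.
- apply: (ac_ae r1).
    by apply: integB; [apply: integD => //; [apply: integN; eauto|eauto]|eauto].
  apply: negligibleS eqn => x /=; apply: contra_not => H xpi;
    have [E _] := eqn' x xpi (H xpi).
  rewrite /re_part /im_part E {E}; case: lam (y x 0 0) (y x 1 0) {eqn' H} =>
    a b [u v] [s t] /=.
  by ring.
- apply: (ac_ae i1).
    by apply: integB; [apply: integD => //; [apply: integN; eauto|eauto]|eauto].
  apply: negligibleS eqn => x /=; apply: contra_not => H xpi;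
    have [E _] := eqn' x xpi (H xpi).
  rewrite /re_part /im_part E {E}; case: lam (y x 0 0) (y x 1 0) {eqn' H} =>
    a b [u v] [s t] /=.
  by ring.
- apply: (ac_ae r2).
    by apply: integB; [apply: integB; eauto|eauto].
  apply: negligibleS eqn => x /=; apply: contra_not => H xpi;
    have [_ E] := eqn' x xpi (H xpi).
  rewrite /re_part /im_part E {E}; case: lam (y x 0 0) (y x 1 0) {eqn' H} =>
    a b [u v] [s t] /=.
  by ring.
- apply: (ac_ae i2).
    by apply: integB; [apply: integB; eauto|eauto].
  apply: negligibleS eqn => x /=; apply: contra_not => H xpi;
    have [_ E] := eqn' x xpi (H xpi).
  rewrite /re_part /im_part E {E}; case: lam (y x 0 0) (y x 1 0) {eqn' H} =>
    a b [u v] [s t] /=.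
  by ring.
Qed.

End SolutionComponents.

(** * Angle and radius of a real solution *)

Section Pruefer.
Context {R : realType} (T : R).
Hypothesis T0 : 0 <= T.
Implicit Types (u v y : R -> R) (a b c x t : R).

Local Notation ac := (ac T).
Local Notation integ := (integ T).
Local Notation bmeas := (bmeas T).

Lemma cosM2 t : cos (2 * t) = cos t ^+ 2 - sin t ^+ 2.
Proof. by rewrite mulrDl mul1r cosD; ring. Qed.

Lemma sinM2 t : sin (2 * t) = 2 * (sin t * cos t).
Proof. by rewrite mulrDl mul1r sinD; ring. Qed.

Variables p q : R -> R.
Hypotheses (ip : integ p) (iq : integ q).

Lemma dirac_unique a b u1 v1 u2 v2 y1 z1 y2 z2 :
  dirac T p q a b u1 v1 u2 v2 -> dirac T p q a b y1 z1 y2 z2 ->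
  u1 0 = y1 0 -> v1 0 = z1 0 -> u2 0 = y2 0 -> v2 0 = z2 0 ->
  forall x, x \in `[0, T] ->
    [/\ u1 x = y1 x, v1 x = z1 x, u2 x = y2 x & v2 x = z2 x].
Proof.
move=> su sy e1 e2 e3 e4 x xT.
have := dirac_lipschitz T0 ip iq su sy.
rewrite {1}/energy /= e1 e2 e3 e4 !subrr expr0n /= !addr0 !mul0r.
move=> /(_ erefl x xT); rewrite /energy /= => E.
have [A B C D] := And4 (sqr_ge0 (u1 x - y1 x)) (sqr_ge0 (v1 x - z1 x))
  (sqr_ge0 (u2 x - y2 x)) (sqr_ge0 (v2 x - z2 x)).
have z r : r ^+ 2 <= 0 -> r = 0 :> R.
  by move=> r0; apply/eqP; rewrite -sqrf_eq0 eq_le r0 sqr_ge0.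
by split; apply/eqP; rewrite -subr_eq0; apply/eqP; apply: z; lra.
Qed.

Lemma dirac_real a u1 v1 u2 v2 :
  dirac T p q a 0 u1 v1 u2 v2 -> dirac T p q a 0 u1 (cst 0) u2 (cst 0).
Proof.
move=> [h1 _ h2 _]; split; rewrite /=.
- by apply: (ac_eq h1) => // x _ /=; ring.
- by apply: (ac_eq (ac_cst T 0)) => // x _ /=; ring.
- by apply: (ac_eq h2) => // x _ /=; ring.
- by apply: (ac_eq (ac_cst T 0)) => // x _ /=; ring.
Qed.

(** The angle and the logarithm of the radius of the plane vector (- y2, y1),
    for a solution (y1, y2) with y1 = 0 and y2 = - 1 at the origin. *)
Definition pruefer a (th rh : R -> R) : Prop :=
  [/\ th 0 = 0, rh 0 = 0,
      ac th (fun x => a + (p x * cos (2 * th x) + q x * sin (2 * th x))) &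
      ac rh (fun x => p x * sin (2 * th x) - q x * cos (2 * th x))].

(** The equations for the angle and the radius are first written with [A] and
    [B] in the place of cos(2 th) and sin(2 th), both computed from the
    solution, and integrated.  The vector (- y2, y1), rotated back by [th] and
    divided by exp(rh), then has zero density and keeps its initial value
    (1, 0), which shows that [A] and [B] are what they stand for. *)
Lemma pruefer_exists a y1 y2 : dirac T p q a 0 y1 (cst 0) y2 (cst 0) ->
  y1 0 = 0 -> y2 0 = -1 ->
  exists th rh, pruefer a th rh /\ forall x, x \in `[0, T] ->
    y1 x = expR (rh x) * sin (th x) /\ y2 x = - (expR (rh x) * cos (th x)).
Proof.
move=> sol y10 y20; have [h1 _ h2 _] := sol.
pose N x := y2 x ^+ 2 + y1 x ^+ 2.
pose A x := (y2 x ^+ 2 - y1 x ^+ 2) / N x.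
pose B x := - (2 * y1 x * y2 x) / N x.
have N0 x : x \in `[0, T] -> 0 < N x.
  move=> xT; have := energy_lower T0 ip iq sol xT.
  rewrite /energy /= y10 y20 => h.
  apply: (@lt_le_trans _ _ (energy y1 (cst 0) y2 (cst 0) x)).
    by apply: lt_le_trans h; rewrite mulr_gt0 ?expR_gt0//; lra.
  by rewrite /energy /N /=; lra.
have by1 := ac_bmeas T0 h1; have by2 := ac_bmeas T0 h2.
have b12 := bmeasM by1 by1; have b22 := bmeasM by2 by2.
have bN : bmeas N by apply: (bmeas_eq _ (bmeasD b22 b12)) => x _; rewrite /N !expr2.
have bA : bmeas A.
  apply: (bmeas_div (u := fun x => y2 x ^+ 2 - y1 x ^+ 2) (M := 1)) => //.
    by apply: (bmeas_eq _ (bmeasB b22 b12)) => x _; rewrite !expr2.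
  move=> x xT; rewrite mul1r [leRHS]ger0_norm ?ler_norml; last exact/ltW/N0.
  by move: (sqr_ge0 (y1 x)) (sqr_ge0 (y2 x)); rewrite /N; lra.
have bB : bmeas B.
  apply: (bmeas_div (u := fun x => - (2 * y1 x * y2 x)) (M := 1)) => //.
    apply: (bmeas_eq _ (bmeasM (bmeas_cst T (-2)) (bmeasM by1 by2))) => x _ /=; ring.
  move=> x xT; rewrite mul1r [leRHS]ger0_norm ?ler_norml; last exact/ltW/N0.
  by move: (sqr_ge0 (y1 x - y2 x)) (sqr_ge0 (y1 x + y2 x)); rewrite /N; nra.
have [e1 e2] : (forall x, x \in `[0, T] -> y1 x * A x + y2 x * B x = - y1 x) /\
    (forall x, x \in `[0, T] -> y1 x * B x - y2 x * A x = - y2 x).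
  by split=> x /N0/lt0r_neq0 Nx; rewrite /A /B; move: Nx; rewrite /N => Nx; field.
pose th := prim (fun x => a + (p x * A x + q x * B x)).
pose rh := prim (fun x => p x * B x - q x * A x).
have ath : ac th (fun x => a + (p x * A x + q x * B x)).
  apply: ac_prim; apply: integD; first exact/integ_bmeas/bmeas_cst.
  by apply: integD; exact: integM.
have arh : ac rh (fun x => p x * B x - q x * A x).
  by apply: ac_prim; apply: integB; exact: integM.
have th0 : th 0 = 0 by rewrite /th prim0.
have rh0 : rh 0 = 0 by rewrite /rh prim0.
have ae := ac_expR T0 (acN arh).
have as_ := ac_sin T0 ath; have ac_ := ac_cos T0 ath.
have aU := acM T0 (acB (acM T0 h1 as_) (acM T0 h2 ac_)) ae.
have aV := acM T0 (acD (acM T0 h1 ac_) (acM T0 h2 as_)) ae.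
have U1 x : x \in `[0, T] ->
    (y1 x * sin (th x) - y2 x * cos (th x)) * expR (- rh x) = 1.
  move=> xT; rewrite (ac_constant aU _ xT).
    by rewrite y10 y20 th0 rh0 oppr0 expR0 cos0 sin0; ring.
  move=> t tT; set e := expR _; set s := sin _; set c := cos _.
  transitivity (e * (c * (p t * (y1 t + (y1 t * A t + y2 t * B t)) +
      q t * (y2 t + (y1 t * B t - y2 t * A t))) +
      s * (q t * (y1 t + (y1 t * A t + y2 t * B t)) -
           p t * (y2 t + (y1 t * B t - y2 t * A t))))).
    by rewrite /cst; ring.
  by rewrite e1// e2//; ring.
have V1 x : x \in `[0, T] ->
    (y1 x * cos (th x) + y2 x * sin (th x)) * expR (- rh x) = 0.
  move=> xT; rewrite (ac_constant aV _ xT).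
    by rewrite y10 y20 th0 rh0 oppr0 expR0 cos0 sin0; ring.
  move=> t tT; set e := expR _; set s := sin _; set c := cos _.
  transitivity (e * (c * (q t * (y1 t + (y1 t * A t + y2 t * B t)) -
      p t * (y2 t + (y1 t * B t - y2 t * A t))) -
      s * (p t * (y1 t + (y1 t * A t + y2 t * B t)) +
           q t * (y2 t + (y1 t * B t - y2 t * A t))))).
    by rewrite /cst; ring.
  by rewrite e1// e2//; ring.
have yE x : x \in `[0, T] ->
    y1 x = expR (rh x) * sin (th x) /\ y2 x = - (expR (rh x) * cos (th x)).
  move=> xT; have := U1 x xT; have := V1 x xT; have := cos2Dsin2 (th x).
  rewrite expRN; have := lt0r_neq0 (expR_gt0 (rh x)).
  move: (expR _) (sin _) (cos _) => e s c e0 cs V U.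
  have {}V : y1 x * c + y2 x * s = 0.
    by move/eqP: V; rewrite mulf_eq0 invr_eq0 (negPf e0) orbF => /eqP.
  have {}U : y1 x * s - y2 x * c = e.
    by move/(congr1 ( *%R^~ e)): U; rewrite divfK// mul1r.
  have -> : y1 x = y1 x * (c ^+ 2 + s ^+ 2) by rewrite cs mulr1.
  have -> : y2 x = y2 x * (c ^+ 2 + s ^+ 2) by rewrite cs mulr1.
  split.
    transitivity ((y1 x * c + y2 x * s) * c + (y1 x * s - y2 x * c) * s); first by ring.
    by rewrite U V; ring.
  transitivity ((y1 x * c + y2 x * s) * s - (y1 x * s - y2 x * c) * c); first by ring.
  by rewrite U V; ring.
have [AE BE] : (forall x, x \in `[0, T] -> A x = cos (2 * th x)) /\
   (forall x, x \in `[0, T] -> B x = sin (2 * th x)).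
  have H x : x \in `[0, T] -> A x = cos (2 * th x) /\ B x = sin (2 * th x).
    move=> xT; rewrite cosM2 sinM2 /A /B /N; have [-> ->] := yE x xT.
    have := cos2Dsin2 (th x); have := lt0r_neq0 (expR_gt0 (rh x)).
    move: (expR _) (sin _) (cos _) => e s c e0 cs.
    have -> : (- (e * c)) ^+ 2 + (e * s) ^+ 2 = e ^+ 2.
      transitivity (e ^+ 2 * (c ^+ 2 + s ^+ 2)); first by ring.
      by rewrite cs mulr1.
    by split; field.
  by split=> x /H[].
exists th, rh; split=> //; split=> //.
- by apply: (ac_eq ath) => // x xT; rewrite AE// BE.
- by apply: (ac_eq arh) => // x xT; rewrite AE// BE.
Qed.

(** The difference psi of the two angles satisfies psi' = (b - a) + c psi,
    where c is a difference quotient bounded by 2 (|p| + |q|).  With C the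
    primitive of c, psi exp(- C) has density (b - a) exp(- C).  The lower
    bound makes the angle strictly increasing in the parameter, the upper one
    makes it continuous. *)
Lemma pruefer_increasing : exists2 K : R, 0 < K & forall a b th rh th' rh',
  pruefer a th rh -> pruefer b th' rh' -> a < b ->
  th T + T / K * (b - a) <= th' T <= th T + K * T * (b - a).
Proof.
pose w x := 2 * (`|p x| + `|q x|).
have iw : integ w by apply: integZ; apply: integD; exact: integ_norm.
have TT : T \in `[0, T] by rewrite in_itv/= lexx T0.
exists (expR (2 * prim w T)); first exact: expR_gt0.
move=> a b th rh th' rh' [th0 _ ath _] [th'0 _ ath' _] ab.
pose psi x := th' x - th x.
pose c1 x := (cos (2 * th' x) - cos (2 * th x)) / psi x.
pose c2 x := (sin (2 * th' x) - sin (2 * th x)) / psi x.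
have apsi := acB ath' ath.
have bth := ac_bmeas T0 ath; have bth' := ac_bmeas T0 ath'.
have bpsi := ac_bmeas T0 apsi.
have b2 u : bmeas u -> bmeas (fun x => 2 * u x) by move=> bu;
  exact: bmeasM (bmeas_cst T 2) bu.
have lip (F F' : R -> R) : (forall x, is_derive x 1 F (F' x)) ->
    (forall x, `|F' x| <= 1) -> forall s t, `|F (2 * t) - F (2 * s)| <= 2 * `|t - s|.
  move=> dF F1 s t; have [c [-> _ _]] := mean_value (2 * s) (2 * t) dF.
  by rewrite -mulrBr !normrM normr_nat ler_piMl// mulr_ge0.
have lc : forall s t, `|cos (2 * t) - cos (2 * s)| <= 2 * `|t - s|.
  by apply: (lip cos (fun x => - sin x)) => x; rewrite normrN sin_max.
have ls : forall s t, `|sin (2 * t) - sin (2 * s)| <= 2 * `|t - s|.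
  by apply: (lip sin cos) => x; rewrite cos_max.
have bc1 : bmeas c1.
  apply: (bmeas_div (M := 2) _ bpsi) => //.
  by apply: bmeasB; apply: bmeas_cos; exact: b2.
have bc2 : bmeas c2.
  apply: (bmeas_div (M := 2) _ bpsi) => //.
  by apply: bmeasB; apply: bmeas_sin; exact: b2.
pose c x := p x * c1 x + q x * c2 x.
have ic : integ c by apply: integD; exact: integM.
(* difference quotients, with the convention that r / 0 = 0 *)
have quo (r s : R) : `|r| <= 2 * `|s| -> r / s * s = r /\ `|r / s| <= 2.
  have [->|s0] := eqVneq s 0.
    rewrite normr0 mulr0 normr_le0 => /eqP ->; rewrite !mul0r normr0.
    by split.
  by move=> rs; rewrite divfK// normrM normfV ler_pdivrMr ?normr_gt0.
have cw x : `|c x| <= w x.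
  rewrite /c /w mulrDr; apply: le_trans (ler_normD _ _) _.
  have [_ k1] := quo _ _ (lc (th x) (th' x)).
  have [_ k2] := quo _ _ (ls (th x) (th' x)).
  rewrite (normrM (p x)) (normrM (q x)) [2 * `|p x|]mulrC [2 * `|q x|]mulrC.
  by apply: lerD; exact: ler_wpM2l.
have aW := acM T0 apsi (ac_expR T0 (acN (ac_prim ic))).
have {}aW : ac (fun x => psi x * expR (- prim c x))
    (fun x => (b - a) * expR (- prim c x)).
  apply: (ac_eq aW) => // x _; rewrite -/(psi x).
  have [k1 _] := quo _ _ (lc (th x) (th' x)).
  have [k2 _] := quo _ _ (ls (th x) (th' x)).
  have -> : b + (p x * cos (2 * th' x) + q x * sin (2 * th' x)) -
      (a + (p x * cos (2 * th x) + q x * sin (2 * th x))) =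
      (b - a) + (p x * (cos (2 * th' x) - cos (2 * th x)) +
                 q x * (sin (2 * th' x) - sin (2 * th x))) by ring.
  by rewrite -{1}k1 -{1}k2 /c /c1 /c2 /psi; ring.
have wT : forall x, x \in `[0, T] -> `|prim c x| <= prim w T.
  move=> x xT; apply: le_trans (prim_norm xT ic) _.
  apply: le_trans (le_prim xT (integ_norm ic) iw (fun t _ => cw t)) _.
  move: xT; rewrite in_itv/= => /andP[x0 xT]; apply: (@prim_mono _ T) => // t _.
  by rewrite /w mulr_ge0// addr_ge0.
have eb : forall x, x \in `[0, T] ->
    expR (- prim w T) <= expR (- prim c x) <= expR (prim w T).
  move=> x /wT; rewrite ler_norml => /andP[k1 k2].
  by rewrite !ler_expR; apply/andP; split; lra.
have ie := ac_bmeas T0 (ac_expR T0 (acN (ac_prim ic))).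
have [_ /(_ T TT)] := aW.
rewrite {2}/psi th0 th'0 subrr mul0r add0r (primZ _ TT); last exact: integ_bmeas.
have : prim (cst (expR (- prim w T))) T <= prim (fun x => expR (- prim c x)) T.
  apply: (@le_prim _ T) => //; [exact/integ_bmeas/bmeas_cst|exact: integ_bmeas|].
  by move=> t /eb/andP[].
have : prim (fun x => expR (- prim c x)) T <= prim (cst (expR (prim w T))) T.
  apply: (@le_prim _ T) => //; [exact: integ_bmeas|exact/integ_bmeas/bmeas_cst|].
  by move=> t /eb/andP[].
rewrite !prim_cst//; set I := prim _ T; set E := expR (prim w T).
have E0 : 0 < E by exact: expR_gt0.
have -> : expR (2 * prim w T) = E * E by rewrite mulrDl mul1r expRD.
rewrite expRN -/E => I1 I2 PE; have := eb T TT; rewrite !expRN -/E in PE *.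
have := expR_gt0 (prim c T); move: (expR (prim c T)) PE => e PE e0 /andP[].
rewrite lef_pV2 ?posrE// => eE Ee.
have {}PE : th' T - th T = (b - a) * I * e.
  by move/(congr1 ( *%R^~ e)): PE; rewrite divfK// lt0r_neq0.
have ba : 0 < b - a by lra.
have Ev : E^-1 <= e by rewrite -[e]invrK lef_pV2 ?posrE// invr_gt0.
have Ep : 0 <= E^-1 by rewrite invr_ge0 ltW.
have -> : th' T = th T + (b - a) * (I * e) by rewrite mulrA -PE; ring.
rewrite ![_ * (b - a)]mulrC !lerD2l !ler_pM2l// invfM mulrA.
apply/andP; split.
  apply: ler_pM => //; first by rewrite mulr_ge0.
  by rewrite mulrC.
have I0 : 0 <= I by apply: le_trans I2; rewrite mulr_ge0.
have -> : E * E * T = (E * T) * E by ring.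
by apply: ler_pM => //; exact: ltW.
Qed.

End Pruefer.

(** * Families with bounded finite sums *)

Section FiniteSums.
Context {R : realType}.

(** Summability over an unordered index type, kept in the real numbers;
    [esum_sums_below] converts it to sums of extended reals. *)
Definition sums_below (I : choiceType) (a : I -> R) (M : R) :=
  forall s : seq I, uniq s -> \sum_(i <- s) a i <= M.

Lemma sums_below_le (I : choiceType) (a b : I -> R) M :
  (forall i, a i <= b i) -> sums_below b M -> sums_below a M.
Proof. by move=> ab bM s us; apply: le_trans (bM s us); exact: ler_sum. Qed.

Lemma sums_belowD (I : choiceType) (a b : I -> R) M N :
  sums_below a M -> sums_below b N -> sums_below (fun i => a i + b i) (M + N).
Proof. by move=> aM bN s us; rewrite big_split/=; apply: lerD; auto. Qed.

Lemma sums_belowZ (I : choiceType) (a : I -> R) c M : 0 <= c ->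
  sums_below a M -> sums_below (fun i => c * a i) (c * M).
Proof. by move=> c0 aM s us; rewrite -mulr_sumr ler_wpM2l// aM. Qed.

Lemma sums_below_inj (I J : choiceType) (f : I -> J) (a : J -> R) M :
  injective f -> sums_below a M -> sums_below (fun i => a (f i)) M.
Proof.
by move=> fi aM s us; rewrite -(big_map f predT a) aM// map_inj_uniq.
Qed.

(** Each value is taken at most once on [P] and at most once off [P].  This
    covers the absolute value of integers, and the numbering of the eigenvalues
    in which 0 occurs twice. *)
Lemma sums_below_two_to_one (I J : choiceType) (f : I -> J) (P : pred I)
    (a : J -> R) M :
  {in P &, injective f} -> {in predC P &, injective f} ->
  sums_below a M -> sums_below (fun i => a (f i)) (2 * M).
Proof.
move=> fP fC aM s us; rewrite (bigID P)/= mulrDl mul1r.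
have part (Q : pred I) : {in Q &, injective f} ->
    \sum_(i <- s | Q i) a (f i) <= M.
  move=> fQ; rewrite -big_filter -(big_map f predT a) aM//.
  rewrite map_inj_in_uniq ?filter_uniq// => i j.
  by rewrite !mem_filter => /andP[Qi _] /andP[Qj _]; exact: fQ.
by apply: lerD; apply: part.
Qed.

Lemma sums_below_number (a : int -> R) M :
  sums_below a M -> sums_below (fun i : eig_index => a (eig_number i)) (2 * M).
Proof.
by apply: (sums_below_two_to_one (P := isSome)) => [[i|] [j|] _ _ //= ->|[i|] [j|]].
Qed.

Lemma esum_sums_below (I : choiceType) (a : I -> R) M :
  sums_below a M -> (\esum_(i in [set: I]) (a i)%:E <= M%:E)%E.
Proof.
move=> aM; apply: ge_ereal_sup => _ [A [finA _] <-].
by rewrite fsbig_finite//= sumEFin lee_fin aM.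
Qed.

(** Comparison with the telescoping sum of 1/(n + 1) - 1/(n + 2). *)
Lemma sums_below_inv_sqr :
  sums_below (fun n : int => (1 + `|n|%N%:R) ^- 2 : R) 4.
Proof.
have -> : (4 : R) = 2 * 2 by ring.
apply: (sums_below_two_to_one (P := fun n : int => 0 <= n) (f := absz)
  (a := fun n : nat => (1 + n%:R) ^- 2 : R)).
- by case=> m [n|n] //= _ _ ->.
- by case=> m [n|n] //= _ _ [->].
move=> s us.
have [N sN] : exists N, forall n, n \in s -> (n < N.+1)%N.
  exists (\max_(n <- s) n) => n ns; rewrite ltnS.
  by have := @leq_bigmax_seq _ s xpredT (fun n => n) n ns isT.
apply: (@le_trans _ _ (\sum_(n <- iota 0 N.+1) (1 + n%:R) ^- 2)).
  apply: (@le_trans _ _ (\sum_(n <- iota 0 N.+1 | n \in s) (1 + n%:R) ^- 2)).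
    rewrite -[leRHS]big_filter le_eqVlt; apply/orP; left; apply/eqP.
    apply: perm_big; apply: uniq_perm => //.
      by rewrite filter_uniq// iota_uniq.
    move=> n; rewrite mem_filter mem_iota add0n leq0n /=.
    by case: (boolP (n \in s)) => // /sN ->.
  rewrite [leRHS](bigID (mem s))/= lerDl sumr_ge0// => n _; rewrite invr_ge0 sqr_ge0.
suff H : \sum_(n <- iota 0 N.+1) (1 + n%:R) ^- 2 <= 2 - (1 + N%:R)^-1 :> R.
  by apply: le_trans H _; rewrite gerBl invr_ge0 addr_ge0.
elim: N {sN} => [|N IH]; first by rewrite big_seq1 addr0 expr1n invr1; lra.
rewrite -addn1 iotaD big_cat/= add0n big_seq1.
apply: le_trans (lerD IH (lexx _)) _; rewrite -[N.+1]addn1 natrD.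
have N0 : 0 <= N%:R :> R by [].
move: (N%:R) N0 => n n0.
rewrite -subr_ge0 -(pmulr_rge0 _ (_ : 0 < (1 + n) * (1 + (n + 1)) ^+ 2)); last first.
  by rewrite mulr_gt0 ?exprn_gt0//; lra.
have -> : (1 + n) * (1 + (n + 1)) ^+ 2 *
   (2 - (1 + (n + 1))^-1 - (2 - (1 + n)^-1 + (1 + (n + 1)) ^- 2)) = 1.
  by field; apply/andP; split; apply: lt0r_neq0; lra.
by [].
Qed.

End FiniteSums.

(** * Bessel's inequality *)

Section Fourier.
Context {R : realType}.
Implicit Types (g h u v : R -> R) (a b c x t : R) (n m k : int).
Local Notation ac := (ac pi).
Local Notation integ := (integ pi).
Local Notation bmeas := (bmeas pi).
Local Notation pi0 := (@pi_ge0 R).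

Lemma pi_in : (pi : R) \in `[0, pi].
Proof. by rewrite in_itv/= lexx pi0. Qed.

Lemma sin_int_pi n : sin (n%:~R * pi) = 0 :> R.
Proof.
have nat_case (m : nat) : sin (m%:R * pi) = 0 :> R.
  elim: m => [|m IH]; first by rewrite mul0r sin0.
  by rewrite -natr1 mulrDl mul1r sinDpi IH oppr0.
case: n => m; first exact: nat_case.
by rewrite NegzE mulrNz mulNr sinN -[_%:~R]/(_%:R) nat_case oppr0.
Qed.

Lemma prim_cos_int k : k != 0 -> prim (fun t => cos (2 * (k%:~R * t))) pi = 0 :> R.
Proof.
move=> k0; have kR : k%:~R != 0 :> R by rewrite intr_eq0.
have := acZ (2 * k%:~R)^-1 (ac_sin pi0 (acZ 2 (acZ k%:~R (ac_id pi)))).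
move=> [_ /(_ pi pi_in)]; rewrite !mulr0 sin0 sinM2 sin_int_pi mul0r !mulr0 add0r.
move=> ->; apply: (eq_prim pi_in) => x _.
by rewrite /cst/=; field.
Qed.

Lemma prim_sin_int k : prim (fun t => sin (2 * (k%:~R * t))) pi = 0 :> R.
Proof.
have [->|k0] := eqVneq k 0.
  transitivity (prim (cst 0) pi : R); last by rewrite prim_cst ?mul0r ?pi0.
  by apply: (eq_prim pi_in) => t _; rewrite mul0r mulr0 sin0.
have kR : k%:~R != 0 :> R by rewrite intr_eq0.
have := acZ (- (2 * k%:~R)^-1) (ac_cos pi0 (acZ 2 (acZ k%:~R (ac_id pi)))).
move=> [_ /(_ pi pi_in)]; rewrite !mulr0 cos0 cosM2 cos2sin2 sin_int_pi.
rewrite expr0n/= !subr0 => /eqP; rewrite -subr_eq0 opprD addrA subrr sub0r oppr_eq0.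
move=> /eqP <-; apply: (eq_prim pi_in) => x _.
by rewrite /cst/=; field.
Qed.


(** The functions cas = cos + sin of Hartley form a single real orthogonal
    family indexed by all integers. *)
Definition hartley n t : R := cos (2 * (n%:~R * t)) + sin (2 * (n%:~R * t)).

Lemma bmeas_lin c : bmeas (fun t => 2 * (c * t)).
Proof. exact: (ac_bmeas pi0 (acZ 2 (acZ c (ac_id pi)))). Qed.

Lemma bmeas_hartley n : bmeas (hartley n).
Proof. by apply: bmeasD; [apply: bmeas_cos|apply: bmeas_sin]; exact: bmeas_lin. Qed.

Lemma hartley_orthogonal m n :
  prim (fun t => hartley m t * hartley n t) pi = if m == n then pi else 0.
Proof.
transitivity (prim (fun t => cos (2 * ((m - n)%:~R * t)) + sin (2 * ((m + n)%:~R * t))) pi : R).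
  apply: (eq_prim pi_in) => t _; rewrite /hartley !intrD mulrNz.
  rewrite ![(_ + _) * t]mulrDl ![2 * (_ + _)]mulrDr mulNr mulrN sinD cosB.
  by ring.
rewrite (primD pi_in); last 2 first.
- by apply: integ_bmeas; apply: bmeas_cos; exact: bmeas_lin.
- by apply: integ_bmeas; apply: bmeas_sin; exact: bmeas_lin.
rewrite prim_sin_int addr0; case: eqVneq => [->|mn]; last first.
  by rewrite prim_cos_int// subr_eq0.
transitivity (prim (cst 1) pi : R); last by rewrite prim_cst ?mul1r ?pi0.
by apply: (eq_prim pi_in) => t _; rewrite subrr mul0r mulr0 cos0.
Qed.

(** The integral of (g - P)^2 is taken over [0, x], whereas the trigonometric
    sum [P] is orthogonal over [0, pi]; extending the integral of P^2 to
    [0, pi] only increases it, so the bound does not depend on x. *)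
Lemma bessel g x : integ g -> integ (fun t => g t ^+ 2) -> x \in `[0, pi] ->
  sums_below (fun n => prim (fun t => g t * hartley n t) x ^+ 2)
    (pi * prim (fun t => g t ^+ 2) pi).
Proof.
move=> ig ig2 xpi s us.
pose c n := prim (fun t => g t * hartley n t) x / pi.
pose P t := \sum_(n <- s) c n * hartley n t.
have bP : bmeas P.
  rewrite /P; elim: (s) => [|n r IH].
    by apply: bmeas_eq (bmeas_cst pi 0) => t _; rewrite big_nil.
  apply: bmeas_eq (bmeasD (bmeasM (bmeas_cst pi (c n)) (bmeas_hartley n)) IH) => t _.
  by rewrite big_cons.
have igh n : integ (fun t => g t * hartley n t) by apply: integM => //;
  exact: bmeas_hartley.
have pi_gt : 0 < pi :> R by exact: pi_gt0.
have cE n : prim (fun t => g t * hartley n t) x = pi * c n.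
  by rewrite /c mulrC divfK// lt0r_neq0.
have PP : prim (fun t => P t * P t) pi = pi * \sum_(n <- s) c n ^+ 2.
  transitivity (prim (fun t => \sum_(m <- s) \sum_(n <- s)
      (c m * c n) * (hartley m t * hartley n t)) pi).
    apply: (eq_prim pi_in) => t _; rewrite /P mulr_suml.
    apply: eq_bigr => m _; rewrite mulr_sumr; apply: eq_bigr => n _; ring.
  have ihh m n : integ (fun t => (c m * c n) * (hartley m t * hartley n t)).
    apply: integZ; apply: integ_bmeas; apply: bmeasM; exact: bmeas_hartley.
  rewrite (prim_sum _ pi_in); last by move=> m; exact: integ_sum.
  rewrite mulr_sumr; apply: eq_big_seq => m ms.
  rewrite (prim_sum _ pi_in)// (bigD1_seq m)//= big1 ?addr0.
    rewrite (primZ _ pi_in); last by apply: integ_bmeas; apply: bmeasM;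
      exact: bmeas_hartley.
    by rewrite hartley_orthogonal eqxx; ring.
  move=> n nm; rewrite (primZ _ pi_in); last by apply: integ_bmeas; apply: bmeasM;
    exact: bmeas_hartley.
  by rewrite hartley_orthogonal eq_sym (negPf nm) mulr0.
have gP : prim (fun t => g t * P t) x = pi * \sum_(n <- s) c n ^+ 2.
  transitivity (prim (fun t => \sum_(n <- s) c n * (g t * hartley n t)) x).
    apply: (eq_prim xpi) => t _; rewrite /P mulr_sumr.
    by apply: eq_bigr => n _; ring.
  rewrite (prim_sum _ xpi); last by move=> n; exact: integZ.
  rewrite mulr_sumr; apply: eq_bigr => n _; rewrite (primZ _ xpi)//.
  by rewrite cE; ring.
have igP : integ (fun t => g t * P t) by exact: integM.
have iP2 : integ (fun t => P t * P t) by apply: integ_bmeas; exact: bmeasM.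
have : 0 <= prim (fun t => g t ^+ 2 - 2 * (g t * P t) + P t * P t) x.
  apply: (prim_ge0 xpi) => t _.
  by have := sqr_ge0 (g t - P t); congr (_ <= _); ring.
rewrite (primD xpi) ?(primB xpi) ?(primZ _ xpi)//; last 2 first.
- exact: integZ.
- by apply: integB => //; exact: integZ.
have /andP[x0 x1] : 0 <= x <= pi by move: xpi; rewrite in_itv.
have : prim (fun t => g t ^+ 2) x <= prim (fun t => g t ^+ 2) pi.
  by apply: (@prim_mono _ pi) => // t _; exact: sqr_ge0.
have : prim (fun t => P t * P t) x <= prim (fun t => P t * P t) pi.
  by apply: (@prim_mono _ pi) => // t _; rewrite -expr2 sqr_ge0.
rewrite PP gP => h1 h2 h3.
have -> : \sum_(n <- s) prim (fun t => g t * hartley n t) x ^+ 2 =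
  pi * (pi * \sum_(n <- s) c n ^+ 2).
  rewrite !mulr_sumr; apply: eq_bigr => n _; rewrite cE; ring.
by rewrite ler_pM2l//; lra.
Qed.

Variables p q : R -> R.
Hypotheses (ip : integ p) (iq : integ q).
Hypotheses (ip2 : integ (fun t => p t ^+ 2)) (iq2 : integ (fun t => q t ^+ 2)).

(** The primitives of the real part and of minus the imaginary part of
    (p + i q) exp(- 2 i n t). *)
Definition fourierA n := prim (fun t => p t * cos (2 * (n%:~R * t)) +
  q t * sin (2 * (n%:~R * t))).
Definition fourierB n := prim (fun t => p t * sin (2 * (n%:~R * t)) -
  q t * cos (2 * (n%:~R * t))).

(** Cosine and sine are the half sum and the half difference of the Hartley
    functions of n and - n. *)
Lemma fourier_square_summable : exists K, forall x, x \in `[0, pi] ->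
  sums_below (fun i : eig_index =>
    fourierA (eig_number i) x ^+ 2 + fourierB (eig_number i) x ^+ 2) K.
Proof.
pose Np := pi * prim (fun t => p t ^+ 2) pi.
pose Nq := pi * prim (fun t => q t ^+ 2) pi.
exists (2 * (Np + Np + (Nq + Nq))) => x xpi.
apply: (@sums_below_number _ (fun n => fourierA n x ^+ 2 + fourierB n x ^+ 2)).
pose P n := prim (fun t => p t * hartley n t) x.
pose Q n := prim (fun t => q t * hartley n t) x.
have opp_inj_int : injective (fun n : int => - n) by exact: oppr_inj.
have SP : sums_below (fun n => P n ^+ 2) Np by exact: bessel.
have SQ : sums_below (fun n => Q n ^+ 2) Nq by exact: bessel.
apply: sums_below_le (sums_belowD
  (sums_belowD SP (sums_below_inj opp_inj_int SP))
  (sums_belowD SQ (sums_below_inj opp_inj_int SQ))) => n.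
have ih g m : integ g -> integ (fun t => g t * hartley m t).
  by move=> ig; apply: integM => //; exact: bmeas_hartley.
have cosE t : cos (2 * (n%:~R * t)) = 2^-1 * (hartley n t + hartley (- n) t).
  by rewrite /hartley mulrNz mulNr mulrN sinN cosN; field.
have sinE t : sin (2 * (n%:~R * t)) = 2^-1 * (hartley n t - hartley (- n) t).
  by rewrite /hartley mulrNz mulNr mulrN sinN cosN; field.
have AE : fourierA n x = 2^-1 * ((P n + P (- n)) + (Q n - Q (- n))).
  rewrite /P /Q -(primD xpi) -?(primB xpi) -?(primD xpi) -?(primZ _ xpi);
    do ?[exact: ih].
  - by apply: (eq_prim xpi) => t _; rewrite cosE sinE; ring.
  - by apply: integD; [apply: integD|apply: integB]; exact: ih.
  - by apply: integD; exact: ih.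
  - by apply: integB; exact: ih.
have BE : fourierB n x = 2^-1 * ((P n - P (- n)) - (Q n + Q (- n))).
  rewrite /P /Q -(primD xpi) -?(primB xpi) -?(primZ _ xpi); do ?[exact: ih].
  - by apply: (eq_prim xpi) => t _; rewrite cosE sinE; ring.
  - by apply: integB; [apply: integB|apply: integD]; exact: ih.
  - by apply: integB; exact: ih.
  - by apply: integD; exact: ih.
rewrite AE BE; move: (P n) (P (- n)) (Q n) (Q (- n)) => r s t u.
by move: (sqr_ge0 (r + u)) (sqr_ge0 (s - t)); lra.
Qed.

End Fourier.

(** * Square summability of the angle and radius remainders *)

Section Remainder.
Context {R : realType}.
Implicit Types (g h u v : R -> R) (a b c x t : R) (n m k : int).
Local Notation ac := (ac pi).
Local Notation integ := (integ pi).
Local Notation bmeas := (bmeas pi).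
Local Notation pi0 := (@pi_ge0 R).

Lemma sums_below_prim (I : choiceType) (f : I -> R -> R) K :
  (forall i, integ (f i)) ->
  (forall t, t \in `[0, pi] -> sums_below (fun i => f i t) K) ->
  sums_below (fun i => prim (f i) pi) (K * pi).
Proof.
move=> fi fK s us; rewrite -(prim_sum _ pi_in)// -(@prim_cst R K pi) ?pi0//.
apply: (le_prim pi_in); [exact: integ_sum|exact/integ_bmeas/bmeas_cst|].
by move=> t tpi; exact: fK.
Qed.

Variables p q : R -> R.
Hypotheses (ip : integ p) (iq : integ q).
Hypotheses (ip2 : integ (fun t => p t ^+ 2)) (iq2 : integ (fun t => q t ^+ 2)).

Let A := fourierA p q.
Let B := fourierB p q.

Lemma ac_fourierA n : ac (A n) (fun t => p t * cos (2 * (n%:~R * t)) +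
  q t * sin (2 * (n%:~R * t))).
Proof.
apply: ac_prim; apply: integD; apply: integM => //.
  by apply: bmeas_cos; exact: bmeas_lin.
by apply: bmeas_sin; exact: bmeas_lin.
Qed.

Lemma ac_fourierB n : ac (B n) (fun t => p t * sin (2 * (n%:~R * t)) -
  q t * cos (2 * (n%:~R * t))).
Proof.
apply: ac_prim; apply: integB; apply: integM => //.
  by apply: bmeas_sin; exact: bmeas_lin.
by apply: bmeas_cos; exact: bmeas_lin.
Qed.

Section Weight.
Variable M : R.
Hypothesis M0 : 0 <= M.

(** Bounds the speed of the angle relative to that of n x, when the spectral
    parameter is within [M] of n. *)
Definition weight t : R := M + (`|p t| + `|q t|).

Lemma integ_weight : integ weight.
Proof.
apply: integD; first exact/integ_bmeas/bmeas_cst.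
by apply: integD; exact: integ_norm.
Qed.

Lemma integ_weight2 : integ (fun t => weight t ^+ 2).
Proof.
have ig : integ (fun t => 3 * (M ^+ 2 + (p t ^+ 2 + q t ^+ 2))).
  by apply: integZ; apply: integD; [exact/integ_bmeas/bmeas_cst|exact: integD].
apply: (le_integrable _ _ _ ig) => //.
  by apply/measurable_EFinP; apply: measurable_funX;
    exact: measurable_integ integ_weight.
move=> t _ /=; rewrite lee_fin.
rewrite !ger0_norm ?sqr_ge0//; last by rewrite mulr_ge0 ?addr_ge0 ?sqr_ge0.
rewrite /weight -[p t ^+ 2]real_normK ?num_real// -[q t ^+ 2]real_normK ?num_real//.
move: (`|p t|) (`|q t|) => r s.
by move: (sqr_ge0 (M - r)) (sqr_ge0 (M - s)) (sqr_ge0 (r - s)); lra.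
Qed.

(** A bound for the squares of the two remainders in [pruefer_remainder] which
    involves n only through the Fourier primitives. *)
Definition remainder n x : R := 4 * (A n x ^+ 2 + B n x ^+ 2) +
  16 * prim (fun t => weight t ^+ 2) pi * prim (fun t => A n t ^+ 2 + B n t ^+ 2) pi.

(** Put E = 2 (th - n x).  The densities of th - a x and of rh are those of the
    Fourier primitives, rotated by the angle E.  Integration by parts leaves
    the rotated primitives, bounded by [D], and an integral of the primitives
    against E', which is at most 2 [weight]; the Cauchy-Schwarz inequality
    bounds this integral. *)
Lemma pruefer_remainder a th rh n x : pruefer pi p q a th rh ->
  `|a - n%:~R| <= M -> x \in `[0, pi] ->
  (th x - a * x) ^+ 2 <= remainder n x /\ rh x ^+ 2 <= remainder n x.
Proof.
move=> [th0 rh0 ath arh] aM xpi.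
pose E t := 2 * (th t - n%:~R * t).
pose E' t := 2 * ((a - n%:~R) + (p t * cos (2 * th t) + q t * sin (2 * th t))).
have aE : ac E E'.
  apply: (ac_eq (acZ 2 (acB ath (acZ n%:~R (ac_id pi))))) => // t _.
  by rewrite /E' /cst; ring.
have aC := ac_cos pi0 aE; have aS := ac_sin pi0 aE.
have aA := ac_fourierA n; have aB := ac_fourierB n.
have [A0 B0] : A n 0 = 0 /\ B n 0 = 0 by rewrite /A /B /fourierA /fourierB !prim0.
pose D t := `|A n t| + `|B n t|.
have thE t : 2 * th t = 2 * (n%:~R * t) + E t by rewrite /E; ring.
have iE' := ac_integ aE.
have bC := ac_bmeas pi0 aC; have bS := ac_bmeas pi0 aS.
have bA := ac_bmeas pi0 aA; have bB := ac_bmeas pi0 aB.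
have b2 : bmeas (fun t => 2 * th t) := bmeasM (bmeas_cst pi 2) (ac_bmeas pi0 ath).
have bD : bmeas D by apply: bmeasD; exact: bmeas_norm.
have E'w t : `|E' t| <= 2 * weight t.
  rewrite /E' normrM normr_nat ler_wpM2l// /weight.
  apply: le_trans (ler_normD _ _) _; apply: lerD => //.
  apply: le_trans (ler_normD _ _) _; rewrite !normrM.
  by apply: lerD; rewrite ler_piMr// ?cos_max ?sin_max.
have rot (r s : R) t : `|r * cos (E t) + s * sin (E t)| <= `|r| + `|s|.
  apply: le_trans (ler_normD _ _) _; rewrite !normrM.
  by apply: lerD; rewrite ler_piMr// ?cos_max ?sin_max.
(* S1 is the boundary term of an integration by parts of v', and u E' what
   remains under the integral sign *)
have bnd u v' (S1 : R -> R) : ac S1 (fun t => v' t + u t * E' t) -> S1 0 = 0 ->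
    integ v' -> bmeas u -> (forall t, `|u t| <= D t) -> (forall t, `|S1 t| <= D t) ->
    prim v' x ^+ 2 <= remainder n x.
  move=> aS1 S10 iv' bu uD SD.
  have iuE : integ (fun t => u t * E' t).
    by apply: (integ_eq _ (integM iE' bu)) => t _; rewrite mulrC.
  have [_ /(_ x xpi)] := aS1; rewrite S10 add0r (primD xpi)// => S1E.
  have iDw : integ (fun t => D t * weight t).
    by apply: (integ_eq _ (integM integ_weight bD)) => t _; rewrite mulrC.
  have X : `|prim (fun t => u t * E' t) x| <= 2 * prim (fun t => D t * weight t) pi.
    apply: le_trans (prim_norm xpi iuE) _.
    rewrite -(primZ _ pi_in)//.
    apply: (@le_trans _ _ (prim (fun t => 2 * (D t * weight t)) x)).
      apply: (le_prim xpi); [exact: integ_norm|exact: integZ|move=> t _].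
      rewrite normrM mulrCA; apply: ler_pM => //; exact: uD.
    move: (xpi); rewrite in_itv/= => /andP[x0 x1].
    apply: (@prim_mono _ pi) => //; first exact: integZ.
    by move=> t _; rewrite !mulr_ge0// !addr_ge0.
  have CS := cauchy_schwarz pi_in bD integ_weight integ_weight2.
  have DD : prim (fun t => D t ^+ 2) pi <= 2 * prim (fun t =>
    A n t ^+ 2 + B n t ^+ 2) pi.
    rewrite -(primZ _ pi_in); last by apply: integD; exact: integ_sqr.
    apply: (le_prim pi_in); [exact: integ_sqr|by apply: integZ; apply: integD;
      exact: integ_sqr|].
    move=> t _; rewrite /D -[A n t ^+ 2]real_normK ?num_real//.
    rewrite -[B n t ^+ 2]real_normK ?num_real//.
    by move: (sqr_ge0 (`|A n t| - `|B n t|)); lra.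
  have Dx : D x ^+ 2 <= 2 * (A n x ^+ 2 + B n x ^+ 2).
    rewrite /D -[A n x ^+ 2]real_normK ?num_real//.
    rewrite -[B n x ^+ 2]real_normK ?num_real//.
    by move: (sqr_ge0 (`|A n x| - `|B n x|)); lra.
  have v'E : prim v' x = S1 x - prim (fun t => u t * E' t) x by rewrite S1E; ring.
  set Y := prim (fun t => D t * weight t) pi in X CS.
  set W := prim (fun t => weight t ^+ 2) pi in CS.
  set Z := prim (fun t => A n t ^+ 2 + B n t ^+ 2) pi in DD.
  have vY : `|prim v' x| <= D x + 2 * Y.
    by rewrite v'E; apply: le_trans (ler_normB _ _) _; exact: lerD (SD x) X.
  have W0 : 0 <= W by apply: (prim_ge0 pi_in) => t _; exact: sqr_ge0.
  have YZ : Y ^+ 2 <= 2 * W * Z.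
    by apply: le_trans CS _; rewrite [2 * W]mulrC -mulrA ler_wpM2l.
  rewrite -[leLHS]real_normK ?num_real// /remainder -/W -/Z.
  have : `|prim v' x| ^+ 2 <= (D x + 2 * Y) ^+ 2.
    by rewrite ler_sqr// nnegrE; exact: le_trans vY.
  by move: (sqr_ge0 (D x - 2 * Y)); lra.
split.
- have -> : th x - a * x = prim (fun t =>
  p t * cos (2 * th t) + q t * sin (2 * th t)) x.
    have [_ /(_ x xpi)] := acB ath (acZ a (ac_id pi)).
    rewrite th0 mulr0 subrr add0r => ->.
    by apply: (eq_prim xpi) => t _; rewrite /cst; ring.
  pose u t := - (B n t * cos (E t) + A n t * sin (E t)).
  apply: (bnd u _ (fun t => A n t * cos (E t) - B n t * sin (E t))).
  + apply: (ac_eq (acB (acM pi0 aA aC) (acM pi0 aB aS))) => // t _.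
    by rewrite thE sinD cosD /u; ring.
  + by rewrite A0 B0 !mul0r subrr.
  + by apply: integD; apply: integM => //; [exact: bmeas_cos|exact: bmeas_sin].
  + by apply: bmeasN; apply: bmeasD; exact: bmeasM.
  + by move=> t; rewrite normrN /D [leRHS]addrC.
  + by move=> t; rewrite -mulNr; apply: le_trans (rot _ _ _) _; rewrite normrN.
- have -> : rh x = prim (fun t => p t * sin (2 * th t) - q t * cos (2 * th t)) x.
    by have [_ /(_ x xpi) ->] := arh; rewrite rh0 add0r.
  pose u t := A n t * cos (E t) - B n t * sin (E t).
  apply: (bnd u _ (fun t => B n t * cos (E t) + A n t * sin (E t))).
  + apply: (ac_eq (acD (acM pi0 aB aC) (acM pi0 aA aS))) => // t _.
    by rewrite thE sinD cosD /u; ring.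
  + by rewrite A0 B0 !mul0r addr0.
  + by apply: integB; apply: integM => //; [exact: bmeas_sin|exact: bmeas_cos].
  + by apply: bmeasB; exact: bmeasM.
  + by move=> t; rewrite /u -mulNr; apply: le_trans (rot _ _ _) _; rewrite normrN.
  + by move=> t; rewrite /D [leRHS]addrC.
Qed.

Lemma remainder_summable : exists2 K : R, 0 <= K & forall x, x \in `[0, pi] ->
  sums_below (fun i : eig_index => remainder (eig_number i) x) K.
Proof.
have [K KP] := fourier_square_summable ip iq ip2 iq2.
set W := prim (fun t => weight t ^+ 2) pi.
have W0 : 0 <= W by apply: (prim_ge0 pi_in) => t _; exact: sqr_ge0.
have K0 : 0 <= K by have /(_ [::] isT) := KP pi pi_in; rewrite big_nil.
exists (4 * K + 16 * W * (K * pi)).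
  by rewrite addr_ge0 ?mulr_ge0// pi0.
move=> x xpi; rewrite /remainder -/W.
apply: sums_belowD; first by apply: sums_belowZ => //; exact: KP.
apply: sums_belowZ; first by rewrite mulr_ge0.
apply: sums_below_prim => [i|t tpi]; last exact: KP.
have b2 u u' : ac u u' -> integ (fun t => u t ^+ 2) by move=> /(ac_bmeas pi0)/integ_sqr.
by apply: integD; [exact: b2 (ac_fourierA _)|exact: b2 (ac_fourierB _)].
Qed.

End Weight.
End Remainder.

(** * Localisation of the eigenvalues *)

Section Localisation.
Context {R : realType}.
Implicit Types (a b c x t s : R) (n m k : int).
Local Notation ac := (ac pi).
Local Notation integ := (integ pi).
Local Notation bmeas := (bmeas pi).
Local Notation pi0 := (@pi_ge0 R).

Lemma sin_eq0_int x : sin x = 0 -> exists k, x = k%:~R * pi.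
Proof.
have pi_gt : 0 < pi :> R by exact: pi_gt0.
move=> sx; exists (Num.floor (x / pi)); set k := Num.floor _.
have /andP[k1 k2] : (k%:~R : R) <= x / pi < (k + 1)%:~R.
  by rewrite floor_le /= floorD1_gt.
have y0 : sin (x - k%:~R * pi) = 0 by rewrite sinB sx sin_int_pi; ring.
apply/eqP; rewrite -subr_eq0 eq_le; apply/andP; split.
  rewrite leNgt; apply/negP => y1.
  have := @sin_gt0_pi R (x - k%:~R * pi); rewrite y0 ltxx y1 /= => H.
  suff : x - k%:~R * pi < pi by move=> /H.
  by move: k2; rewrite ltr_pdivrMr// intrD mulrDl mul1r; lra.
by rewrite subr_ge0 -ler_pdivlMr.
Qed.

(** With g = pi / 2 - atan t and t > 0 the claim is g cos g <= sin g, and by the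
    mean value theorem sin g = g cos c with |c| <= g. *)
Lemma acot_le t : (pi / 2 - atan t) * t <= 1.
Proof.
have g1 := atan_gtNpi2 t; have g2 := atan_ltpi2 t.
have [t0|t0] := leP t 0; first by apply: le_trans ler01; rewrite mulr_ge0_le0//; lra.
set g := pi / 2 - atan t.
have a0 : 0 < atan t by rewrite -atan0 lt_atan.
have g0 : 0 < g by rewrite /g; lra.
have gpi : g < pi / 2 by rewrite /g; lra.
have sg : 0 < sin g by rewrite sin_gt0_pihalf// g0.
have tE : t = cos g / sin g.
  rewrite -[LHS]atanK /tan /g.
  have -> : atan t = - (g - pi / 2) by rewrite /g; ring.
  by rewrite sinN cosN sinBpihalf cosBpihalf opprK; congr (cos _ / sin _);
    rewrite /g; ring.
rewrite tE mulrA ler_pdivrMr// mul1r.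
have [c []] := mean_value (F' := cos) 0 g (@is_derive_sin R).
rewrite sin0 !subr0 => -> cg _; rewrite mulrC ler_wpM2r//; first exact: ltW.
rewrite -[leRHS]cos_norm.
have [->//|ne] := eqVneq `|c| g.
rewrite (gtr0_norm g0) in cg; have pg := pi_gt0 R.
have cpi : `|c| \in `[0, pi] by rewrite in_itv/= normr_ge0/=; lra.
have gin : g \in `[0, pi] by rewrite in_itv/=; lra.
by rewrite ltW// ltr_cos// lt_neqAle ne.
Qed.

Variables p q : R -> R.
Hypotheses (ip : integ p) (iq : integ q).
Variables th rh : R -> R -> R.
Hypothesis thP : forall a, pruefer pi p q a (th a) (rh a).
Variables h1 h2 : R.
Hypothesis h2_gt0 : 0 < h2.

Lemma phase_le a x : x \in `[0, pi] ->
  `|th a x - a * x| <= prim (fun t => `|p t| + `|q t|) pi.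
Proof.
move=> xpi; have [th0 _ ath _] := thP a.
have [i1 /(_ x xpi)] := acB ath (acZ a (ac_id pi)).
rewrite th0 mulr0 subrr add0r => ->.
have iw : integ (fun t => `|p t| + `|q t|) by apply: integD; exact: integ_norm.
apply: le_trans (prim_norm xpi i1) _.
apply: le_trans (le_prim xpi (integ_norm i1) iw _) _.
  move=> t _; set c := cos _; set s := sin _.
  have -> : a + (p t * c + q t * s) - a * cst 1 t = p t * c + q t * s.
    by rewrite /cst; ring.
  apply: le_trans (ler_normD _ _) _; rewrite !normrM.
  by apply: lerD; rewrite ler_piMr// ?cos_max ?sin_max.
move: xpi; rewrite in_itv/= => /andP[x0 x1].
by apply: (@prim_mono _ pi) => // t _; rewrite addr_ge0.
Qed.

Lemma amplitude_le a x : x \in `[0, pi] ->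
  `|rh a x| <= prim (fun t => `|p t| + `|q t|) pi.
Proof.
move=> xpi; have [_ rh0 _ [i1 /(_ x xpi)]] := thP a.
rewrite rh0 add0r => ->.
have iw : integ (fun t => `|p t| + `|q t|) by apply: integD; exact: integ_norm.
apply: le_trans (prim_norm xpi i1) _.
apply: le_trans (le_prim xpi (integ_norm i1) iw _) _.
  move=> t _; apply: le_trans (ler_normB _ _) _; rewrite !normrM.
  by apply: lerD; rewrite ler_piMr// ?cos_max ?sin_max.
move: xpi; rewrite in_itv/= => /andP[x0 x1].
by apply: (@prim_mono _ pi) => // t _; rewrite addr_ge0.
Qed.

(** The excess of th over the argument of (a + h1) + i h2, as the boundary
    condition says that tan(th) = h2 / (a + h1). *)
Definition angle a : R := th a pi + atan ((a + h1) / h2) - pi / 2.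

(** Up to a positive factor, the left-hand side is the sine of [angle a]. *)
Lemma boundary_angle a :
  ((a + h1) * sin (th a pi) - h2 * cos (th a pi) = 0) <->
  exists k, angle a = k%:~R * pi.
Proof.
set t := (a + h1) / h2.
have g1 := atan_gtNpi2 t; have g2 := atan_ltpi2 t.
have c0 : 0 < cos (atan t) by rewrite cos_gt0_pihalf// g1.
have E : (a + h1) * sin (th a pi) - h2 * cos (th a pi) =
    h2 / cos (atan t) * sin (angle a).
  have -> : a + h1 = h2 * (sin (atan t) / cos (atan t)).
    by rewrite -/(tan _) atanK /t mulrC divfK// lt0r_neq0.
  have -> : angle a = (th a pi + atan t) - pi / 2 by [].
  by rewrite sinBpihalf cosD; field; exact: lt0r_neq0.
rewrite E; split=> [/eqP|[k ->]]; last by rewrite sin_int_pi mulr0.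
rewrite mulf_eq0 mulf_eq0 invr_eq0 (gt_eqF h2_gt0) (gt_eqF c0) /= => /eqP.
exact: sin_eq0_int.
Qed.

Lemma angle_growth : exists2 d : R, 0 < d & forall a b, a < b ->
  angle a + d * (b - a) <= angle b.
Proof.
have [K K0 KP] := pruefer_increasing pi0 ip iq.
exists (pi / K); first by rewrite divr_gt0// pi_gt0.
move=> a b ab; have /andP[H _] := KP _ _ _ _ _ _ (thP a) (thP b) ab.
have : atan ((a + h1) / h2) <= atan ((b + h1) / h2).
  by rewrite le_atan// ler_wpM2r ?invr_ge0 ?(ltW h2_gt0)// lerD2r ltW.
by rewrite /angle; lra.
Qed.

Lemma angle_lt a b : a < b -> angle a < angle b.
Proof.
have [d d0 H] := angle_growth => ab; apply: lt_le_trans (H a b ab).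
by rewrite ltrDl mulr_gt0// subr_gt0.
Qed.

Lemma angle_inj : injective angle.
Proof.
move=> a b E; apply/eqP; rewrite eq_le !leNgt; apply/andP.
by split; apply/negP => /angle_lt; rewrite E ltxx.
Qed.

Lemma angle_continuous : continuous angle.
Proof.
have [K K0 KP] := pruefer_increasing pi0 ip iq.
have lip a b : `|th b pi - th a pi| <= K * pi * `|b - a|.
  have [ab|ba|->] := ltgtP a b; last by rewrite !subrr normr0 mulr0.
    have /andP[H1 H2] := KP _ _ _ _ _ _ (thP a) (thP b) ab.
    have P0 : 0 <= pi / K * (b - a).
      by rewrite mulr_ge0 ?divr_ge0 ?pi0 ?(ltW K0)// subr_ge0 ltW.
    by rewrite [`|b - a|]gtr0_norm ?subr_gt0// ger0_norm; lra.
  have /andP[H1 H2] := KP _ _ _ _ _ _ (thP b) (thP a) ba.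
  have P0 : 0 <= pi / K * (a - b).
    by rewrite mulr_ge0 ?divr_ge0 ?pi0 ?(ltW K0)// subr_ge0 ltW.
  by rewrite [`|b - a|]ltr0_norm ?subr_lt0// ler0_norm; lra.
have cth : continuous (fun a => th a pi).
  move=> a; apply/cvgrPdist_le => e e0.
  have Kp : 0 < K * pi by rewrite mulr_gt0// pi_gt0.
  near=> b; rewrite distrC; apply: le_trans (lip a b) _.
  rewrite -ler_pdivlMl// distrC; near: b.
  by apply: cvgr_dist_le => //; rewrite mulr_gt0// invr_gt0.
move=> a; rewrite /continuous_at /angle; apply: cvgB; last exact: cvg_cst.
apply: cvgD; first exact: cth.
apply: continuous_cvg; first exact: continuous_atan.
by apply: cvgM; [apply: cvgD; [exact: cvg_id|exact: cvg_cst]|exact: cvg_cst].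
Unshelve. all: by end_near.
Qed.

Lemma angle_surj v : exists a, angle a = v.
Proof.
have [d d0 H] := angle_growth.
pose r := (`|v - angle 0| + 1) / d.
have r0 : 0 < r by rewrite divr_gt0// addr_gt0.
have dr : d * r = `|v - angle 0| + 1 by rewrite /r mulrC divfK// lt0r_neq0.
have := ler_norm (v - angle 0); have := ler_norm (- (v - angle 0)); rewrite normrN.
move=> n1 n2; have u1 := H 0 r r0; rewrite subr0 dr in u1.
have u2 := H (- r) 0; rewrite sub0r opprK dr oppr_lt0 in u2; have {}u2 := u2 r0.
have [|||a _ <-] := @IVT R angle (- r) r v; first by lra.
- by apply: continuous_subspaceT; exact: angle_continuous.
- by rewrite min_l ?max_r//; lra.
by exists a.
Qed.

(** The multiple of pi attained by [angle] at each eigenvalue.  The arc tangent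
    in [angle] is close to pi / 2 for large positive eigenvalues and to
    - pi / 2 for large negative ones, which shifts the negative numbers by one
    and leaves - 1 for the additional index. *)
Definition branch (i : eig_index) : int :=
  match i with
  | Some (Posz n) => Posz n
  | Some (Negz n) => Negz n.+1
  | None => Negz 0
  end.

Lemma branch_inj : injective branch.
Proof. by move=> [[m|m]|] [[n|n]|] //= [->]. Qed.

Lemma branch_surj k : exists i, branch i = k.
Proof.
case: k => [n|[|n]]; first by exists (Some (Posz n)).
- by exists None.
- by exists (Some (Negz n)).
Qed.

(** At the eigenvalue number n the distance from th to n pi is the arc cotangent
    of (lam + h1) / h2 for the indices [Some n] with n >= 0, and of the opposite
    for the other indices.  It is at most pi, which with [phase_le] bounds the
    distance from lam to n; the argument of the arc cotangent is then of order
    |n|, and [acot_le] applies. *)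
Lemma eigenvalue_localisation : exists lam : eig_index -> R,
  [/\ injective lam,
      forall a, ((a + h1) * sin (th a pi) - h2 * cos (th a pi) = 0) <->
        (exists i, lam i = a),
      exists2 M : R, 0 <= M & forall i, `|lam i - (eig_number i)%:~R| <= M &
      exists2 C : R, 0 <= C & forall i,
        `|(eig_number i)%:~R * pi - th (lam i) pi| * (1 + `|eig_number i|%N%:R) <= C].
Proof.
have pi_gt : 0 < pi :> R by exact: pi_gt0.
pose lam i := sval (cid (angle_surj ((branch i)%:~R * pi))).
have lamE i : angle (lam i) = (branch i)%:~R * pi by rewrite /lam; case: cid.
pose L := prim (fun t => `|p t| + `|q t|) pi.
have L0 : 0 <= L by apply: (prim_ge0 pi_in) => t _; rewrite addr_ge0.
pose g (i : eig_index) := let t := (lam i + h1) / h2 in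
  if i is Some (Posz n) then t else - t.
have gap i : `|(eig_number i)%:~R * pi - th (lam i) pi| = pi / 2 - atan (g i).
  have := lamE i; rewrite /angle /g.
  have := atan_gtNpi2 ((lam i + h1) / h2); have := atan_ltpi2 ((lam i + h1) / h2).
  case: i => [[n|n]|] /=; set t := atan _ => t1 t2 E.
  - rewrite ler0_norm; lra.
  - have e : (Negz n.+1)%:~R = (Negz n)%:~R - 1 :> R.
      by rewrite !NegzE !mulrNz -[n.+2]addn1 PoszD intrD; ring.
    rewrite e in E; rewrite atanN -/t ger0_norm; lra.
  - rewrite mulrN1z in E; rewrite atanN -/t ger0_norm; lra.
have gap0 i : 0 <= pi / 2 - atan (g i) <= pi.
  by have := atan_gtNpi2 (g i); have := atan_ltpi2 (g i); lra.
have lamM i : `|lam i - (eig_number i)%:~R| <= 1 + L / pi.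
  have /andP[_ gp] := gap0 i; rewrite -gap in gp.
  have Pp := phase_le (lam i) pi_in; rewrite -/L in Pp.
  rewrite -(ler_pM2r pi_gt) mulrDl divfK ?lt0r_neq0// mul1r.
  rewrite -{1}[pi]gtr0_norm// -normrM.
  have -> : (lam i - (eig_number i)%:~R) * pi = - ((eig_number i)%:~R * pi -
    th (lam i) pi) - (th (lam i) pi - lam i * pi) by ring.
  by apply: le_trans (ler_normB _ _) _; rewrite normrN; exact: lerD.
exists lam; split.
- move=> i j E; apply: branch_inj.
  have := lamE i; rewrite E lamE => /(mulIf (lt0r_neq0 pi_gt))/eqP.
  by rewrite eqr_int => /eqP.
- move=> a; rewrite boundary_angle; split=> [[k kE]|[i <-]]; last first.
    by exists (branch i).
  have [i ik] := branch_surj k; exists i.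
  by apply: angle_inj; rewrite lamE ik kE.
- by exists (1 + L / pi) => //; rewrite addr_ge0// divr_ge0// ltW.
(* |n| - M' is a lower bound for h2 times the argument of the arc cotangent,
   unless n = 0 *)
pose M' := 1 + L / pi + `|h1|.
have M'0 : 0 <= M' by rewrite !addr_ge0// divr_ge0// ltW.
exists (h2 + pi * (M' + 1)).
  by rewrite addr_ge0 ?(ltW h2_gt0)// mulr_ge0 ?(ltW pi_gt)// addr_ge0.
move=> i; rewrite gap; have /andP[g0 g1] := gap0 i.
have H1 : `|eig_number i|%N%:R - M' <= h2 * g i \/ eig_number i = 0.
  have := lamM i; rewrite ler_norml => /andP[l1 l2].
  have := ler_norm h1; have := ler_norm (- h1); rewrite normrN => n1 n2.
  have hg t : h2 * ((t + h1) / h2) = t + h1 by rewrite mulrC divfK// lt0r_neq0.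
  case: i l1 l2 {g0 g1} => [[n|n]|] /= l1 l2; [left|left|by right].
  - by rewrite /g hg /M'; move: l1; rewrite -[_%:~R]/(_%:R); lra.
  - rewrite /g mulrN hg /M'; move: l2; rewrite NegzE mulrNz -[_%:~R]/(n.+1%:R).
    by lra.
set w := pi / 2 - atan (g i) in g0 g1 *.
case: H1 => [H1|->]; last first.
  rewrite addr0 mulr1; apply: le_trans g1 _.
  by rewrite -[leLHS]add0r; apply: lerD; [exact: ltW|];
    rewrite ler_peMr ?(ltW pi_gt)// lerDr.
have H2 : w * (h2 * g i) <= h2.
  by rewrite mulrCA -[leRHS]mulr1 ler_wpM2l ?(ltW h2_gt0)// acot_le.
have H3 := ler_wpM2l g0 H1.
have H4 : w * (M' + 1) <= pi * (M' + 1) by rewrite ler_wpM2r// addr_ge0.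
by move: H2 H3 H4; move: (_%:R) (h2 * g i) => N z; lra.
Qed.

End Localisation.

(** * Lipschitz continuity at a point of the complex plane *)

Section ComplexFunctions.
Context {R : realType}.
Local Notation C := R[i].
Implicit Types (f g : C -> C) (z w : C).

Lemma sqnormM z w : sqnorm (z * w) = sqnorm z * sqnorm w.
Proof. by case: z => a b; case: w => c d; rewrite /sqnorm /=; ring. Qed.

Lemma sqnorm_ge0 z : 0 <= sqnorm z.
Proof. by rewrite /sqnorm addr_ge0 ?sqr_ge0. Qed.

Lemma sqnormD_le z w : sqnorm (z + w) <= 2 * (sqnorm z + sqnorm w).
Proof.
case: z => a b; case: w => c d; rewrite /sqnorm /=.
by move: (sqr_ge0 (a - c)) (sqr_ge0 (b - d)); lra.
Qed.

Lemma normC_le z (e : R) : 0 <= e -> (`|z| <= e%:C) = (sqnorm z <= e ^+ 2).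
Proof.
move=> e0; rewrite normc_def lecE/= eqxx/= -[LHS]ler_sqr ?nnegrE ?sqrtr_ge0//.
by rewrite sqr_sqrtr// addr_ge0// sqr_ge0.
Qed.

Lemma normC_lt z (e : R) : 0 < e -> (`|z| < e%:C) = (sqnorm z < e ^+ 2).
Proof.
move=> e0; rewrite normc_def ltcE/= eqxx/=.
rewrite -[LHS]ltr_sqr ?nnegrE ?sqrtr_ge0 ?(ltW e0)//.
by rewrite sqr_sqrtr// addr_ge0// sqr_ge0.
Qed.

(** A form of continuity at a point that passes to sums and products by plain
    inequalities between squared moduli. *)
Definition lipschitz_near f z := exists2 K : R, 0 <= K & forall w,
  sqnorm (w - z) <= 1 -> sqnorm (f w - f z) <= K * sqnorm (w - z).

Lemma lipschitz_near_continuous f z :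
  lipschitz_near f z -> {for z, continuous (f : C^o -> C^o)}.
Proof.
move=> [K K0 H].
have F := nbhs_filter (z : C^o).
apply/(@cvgrPdist_le _ C^o _ _ F f (f z)) => e e0.
have eE : e = (complex.Re e)%:C.
  by move: e0; case: e => a b; rewrite ltcE/= => /andP[/eqP-> _].
have e0' : 0 < complex.Re e by move: e0; rewrite eE ltcE/= eqxx.
set r := complex.Re e in eE e0'.
pose d := Num.min 1 (r / (1 + K)).
have K1 : 0 < 1 + K by rewrite ltr_wpDr.
have d0 : 0 < d by rewrite lt_min ltr01 divr_gt0.
apply/nbhs_ballP; exists d%:C; first by rewrite /= ltcE/= eqxx d0.
move=> w; rewrite -ball_normE /= distrC normC_lt// => wd.
rewrite distrC eE normC_le; last exact: ltW.
have d1 : d <= 1 by rewrite ge_min lexx.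
have dr : d <= r / (1 + K) by rewrite ge_min lexx orbT.
have w1 : sqnorm (w - z) <= 1.
  by apply: le_trans (ltW wd) _; rewrite expr_le1// ltW.
apply: le_trans (H w w1) _.
have dr2 : d * (1 + K) <= r by rewrite -ler_pdivlMr.
apply: (@le_trans _ _ (K * d ^+ 2)); first by rewrite ler_wpM2l// ltW.
apply: (@le_trans _ _ ((d * (1 + K)) ^+ 2)); last first.
  by rewrite ler_sqr// nnegrE; [rewrite mulr_ge0// ltW | exact: ltW].
rewrite exprMn mulrC ler_wpM2l ?sqr_ge0//.
by move: (sqr_ge0 K); rewrite sqrrD; lra.
Qed.

Lemma lipschitz_near_cst c z : lipschitz_near (fun=> c) z.
Proof.
by exists 0 => // w _; rewrite subrr mul0r /sqnorm /= expr0n /= addr0.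
Qed.

Lemma lipschitz_near_id z : lipschitz_near id z.
Proof. by exists 1 => // w _; rewrite mul1r. Qed.

Lemma lipschitz_nearD f g z : lipschitz_near f z -> lipschitz_near g z ->
  lipschitz_near (fun w => f w + g w) z.
Proof.
move=> [K K0 H] [L L0 G]; exists (2 * (K + L)); first by rewrite mulr_ge0// addr_ge0.
move=> w w1; have -> : f w + g w - (f z + g z) = (f w - f z) + (g w - g z) by ring.
apply: le_trans (sqnormD_le _ _) _; rewrite -mulrA ler_wpM2l// mulrDl.
by apply: lerD; [exact: H|exact: G].
Qed.

Lemma lipschitz_nearM f g z : lipschitz_near f z -> lipschitz_near g z ->
  lipschitz_near (fun w => f w * g w) z.
Proof.
move=> [K K0 H] [L L0 G].
exists (2 * (K * (2 * (L + sqnorm (g z))) + sqnorm (f z) * L)).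
  have gz := sqnorm_ge0 (g z); have fz := sqnorm_ge0 (f z).
  by rewrite mulr_ge0// addr_ge0// ?mulr_ge0// addr_ge0.
move=> w w1.
have -> : f w * g w - f z * g z = (f w - f z) * g w + f z * (g w - g z) by ring.
apply: le_trans (sqnormD_le _ _) _; rewrite -mulrA ler_wpM2l// [leRHS]mulrDl !sqnormM.
apply: lerD.
  rewrite mulrAC; apply: ler_pM; rewrite ?sqnorm_ge0//; first exact: H.
  have -> : g w = (g w - g z) + g z by ring.
  apply: le_trans (sqnormD_le _ _) _; rewrite ler_wpM2l// lerD2r.
  by apply: le_trans (G w w1) _; rewrite ler_piMr.
by rewrite -mulrA ler_wpM2l ?sqnorm_ge0// G.
Qed.

Lemma zero_order0 f z : lipschitz_near f z -> f z != 0 -> zero_order f z 0.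
Proof.
move=> Lf fz; exists f; split=> //; first exact: lipschitz_near_continuous.
by move=> w; rewrite expr0 mul1r.
Qed.

End ComplexFunctions.

(** * Dependence on the spectral parameter *)

Section DiracFamily.
Context {R : realType}.
Local Notation C := R[i].
Local Notation integ := (integ pi).
Local Notation pi0 := (@pi_ge0 R).
Variables p q : R -> R.
Hypotheses (ip : integ p) (iq : integ q).
Variables u1 v1 u2 v2 : C -> R -> R.
Hypothesis sol : forall w, dirac pi p q (complex.Re w) (complex.Im w)
  (u1 w) (v1 w) (u2 w) (v2 w).
Hypothesis init : forall w, [/\ u1 w 0 = 0, v1 w 0 = 0, u2 w 0 = -1 & v2 w 0 = 0].
Implicit Types z w : C.

Let E w := energy (u1 w) (v1 w) (u2 w) (v2 w).
Let dE w z := energy (u1 w \- u1 z) (v1 w \- v1 z) (u2 w \- u2 z) (v2 w \- v2 z).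

Lemma energy_init w : E w 0 = 1.
Proof. by rewrite /E /energy; have [-> -> -> ->] := init w; ring. Qed.

Lemma energy_gt0 w x : x \in `[0, pi] -> 0 < E w x.
Proof.
move=> xpi; apply: lt_le_trans (energy_lower pi0 ip iq (sol w) xpi).
by rewrite -/(E w) energy_init mul1r expR_gt0.
Qed.

Lemma ac_energy_family w : integ (E w).
Proof.
have [a1 a2 a3 a4] := sol w.
exact: integ_bmeas (ac_bmeas pi0 (ac_energy pi0 a1 a2 a3 a4)).
Qed.

Lemma prim_energy_gt0 w : 0 < prim (E w) pi.
Proof.
set m := expR (- prim (growth p q (complex.Im w)) pi).
have m0 : 0 < m by exact: expR_gt0.
apply: (@lt_le_trans _ _ (m * pi)); first by rewrite mulr_gt0// pi_gt0.
rewrite -(prim_cst _ pi0); apply: (le_prim pi_in).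
- exact/integ_bmeas/bmeas_cst.
- exact: ac_energy_family.
- move=> t tpi; apply: le_trans (energy_lower pi0 ip iq (sol w) tpi).
  by rewrite -/(E w) energy_init mul1r.
Qed.

(** In the disc of radius 1 around z the imaginary part of the parameter, hence
    the growth rate, is bounded by its value at z plus a constant. *)
Lemma dirac_family_lipschitz z : exists2 K : R, 0 <= K & forall w,
  sqnorm (w - z) <= 1 ->
  forall x, x \in `[0, pi] -> dE w z x <= K * sqnorm (w - z).
Proof.
set b0 := complex.Im z.
pose G t := growth p q b0 t + 2 + 1.
exists ((E z 0 * expR (prim (growth p q b0) pi) * pi) * expR (prim G pi)).
  by rewrite !mulr_ge0 ?expR_ge0 ?energy_ge0 ?pi0.
move=> w w1 x xpi.
have d0 : dE w z 0 = 0.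
  rewrite /dE /energy /=; have [-> -> -> ->] := init w.
  by have [-> -> -> ->] := init z; ring.
apply: le_trans (dirac_lipschitz pi0 ip iq (sol w) (sol z) d0 xpi) _.
rewrite -/b0 -/(E z).
have -> : (complex.Re w - complex.Re z) ^+ 2 + (complex.Im w - b0) ^+ 2 =
  sqnorm (w - z).
  by rewrite /b0; case: (w) (z) => [a b] [c d].
rewrite -mulrA mulrC; apply: ler_wpM2r; first exact: sqnorm_ge0.
apply: ler_wpM2l; first by rewrite !mulr_ge0 ?expR_ge0 ?energy_ge0 ?pi0.
have ig b : integ (growth p q b) by exact: integ_growth.
rewrite ler_expR; apply: (le_prim pi_in).
- by apply: integD => //; exact/integ_bmeas/bmeas_cst.
- by apply: integD; [apply: integD => //|]; exact/integ_bmeas/bmeas_cst.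
move=> t _; rewrite /G lerD2r /growth.
have wz : `|complex.Im w| <= `|b0| + 1.
  have -> : complex.Im w = b0 + (complex.Im w - b0) by ring.
  apply: le_trans (ler_normD _ _) _; rewrite lerD2l.
  rewrite -(@expr_le1 _ 2)// real_normK ?num_real//; apply: le_trans w1.
  rewrite /b0; case: (w) (z) => [a b] [c d]; rewrite /sqnorm /=.
  by rewrite lerDr sqr_ge0.
by lra.
Qed.

Definition end1 w : C := u1 w pi +i* v1 w pi.
Definition end2 w : C := u2 w pi +i* v2 w pi.

Lemma end_lipschitz z : lipschitz_near end1 z /\ lipschitz_near end2 z.
Proof.
have [K K0 H] := dirac_family_lipschitz z.
by split; exists K => // w w1; apply: le_trans (H w w1 _ pi_in);
  rewrite /end1 /end2 /sqnorm /dE /energy /=;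
  [move: (sqr_ge0 (u2 w pi - u2 z pi)) (sqr_ge0 (v2 w pi - v2 z pi))
  |move: (sqr_ge0 (u1 w pi - u1 z pi)) (sqr_ge0 (v1 w pi - v1 z pi))]; lra.
Qed.

Section RealPoint.
Variable r : R.
Local Notation y1 := (u1 r%:C).
Local Notation y2 := (u2 r%:C).

Lemma real_solution : dirac pi p q r 0 y1 (cst 0) y2 (cst 0).
Proof. exact: dirac_real (sol r%:C). Qed.

Lemma real_im0 x : x \in `[0, pi] -> v1 r%:C x = 0 /\ v2 r%:C x = 0.
Proof.
have [i1 i2 i3 i4] := init r%:C.
by move=> /(dirac_unique pi0 ip iq (sol r%:C) real_solution erefl i2 erefl i4)[].
Qed.

Definition green w : C :=
  prim (fun t => u1 w t * y1 t + u2 w t * y2 t) pi +i*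
  prim (fun t => v1 w t * y1 t + v2 w t * y2 t) pi.

(** [dirac_bilinear_wronskian] integrated over [0, pi]; the boundary terms at 0
    vanish because the first components do. *)
Lemma green_identity w :
  end2 w * (y1 pi)%:C - end1 w * (y2 pi)%:C = (w - r%:C) * green w.
Proof.
have [H1 H2] := dirac_bilinear_wronskian pi0 (sol w) real_solution.
have [h1 k1 h2 k2] := sol w; have [j1 _ j2 _] := real_solution.
have i1 := integD (integ_bmeas (bmeasM (ac_bmeas pi0 h1) (ac_bmeas pi0 j1)))
  (integ_bmeas (bmeasM (ac_bmeas pi0 h2) (ac_bmeas pi0 j2))).
have i2 := integD (integ_bmeas (bmeasM (ac_bmeas pi0 k1) (ac_bmeas pi0 j1)))
  (integ_bmeas (bmeasM (ac_bmeas pi0 k2) (ac_bmeas pi0 j2))).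
have [z1 z2 z3 z4] := init w; have [y10 _ _ _] := init r%:C.
have [_ /(_ pi pi_in)] := H1; have [_ /(_ pi pi_in)] := H2.
rewrite z1 z2 z3 z4 y10 (primD pi_in) ?(primB pi_in); try exact: integZ.
rewrite !(primZ _ pi_in)// !mul0r !mulr0 !subrr !add0r.
move=> e2 e1.
have -> : w - r%:C = (complex.Re w - r) +i* complex.Im w.
  by case: (w) => a b; apply/eqP; rewrite eq_complex /= subr0 !eqxx.
apply/eqP; rewrite eq_complex /=; apply/andP; split; apply/eqP.
- by transitivity (u2 w pi * y1 pi - u1 w pi * y2 pi); [|rewrite e1]; ring.
- by transitivity (v2 w pi * y1 pi - v1 w pi * y2 pi); [|rewrite e2]; ring.
Qed.

Lemma green_lipschitz : lipschitz_near green r%:C.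
Proof.
have [K K0 H] := dirac_family_lipschitz r%:C.
exists (pi * (K * prim (E r%:C) pi)).
  by rewrite !mulr_ge0 ?pi0//; exact/ltW/prim_energy_gt0.
move=> w w1; set s := sqnorm (w - r%:C).
pose f t := (u1 w t - y1 t) * y1 t + (u2 w t - y2 t) * y2 t.
pose g t := (v1 w t - v1 r%:C t) * y1 t + (v2 w t - v2 r%:C t) * y2 t.
have [/(ac_bmeas pi0) a1 /(ac_bmeas pi0) a2 /(ac_bmeas pi0) a3 /(ac_bmeas pi0) a4] := sol w.
have [/(ac_bmeas pi0) b1 /(ac_bmeas pi0) b2 /(ac_bmeas pi0) b3 /(ac_bmeas pi0) b4] := sol r%:C.
have bf : bmeas pi f by apply: bmeasD; apply: bmeasM => //; exact: bmeasB.
have bg : bmeas pi g by apply: bmeasD; apply: bmeasM => //; exact: bmeasB.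
have -> : sqnorm (green w - green r%:C) = prim f pi ^+ 2 + prim g pi ^+ 2.
  rewrite /green /sqnorm /= -!(primB pi_in); last first.
  - by apply: integD; apply: integ_bmeas; exact: bmeasM.
  - by apply: integD; apply: integ_bmeas; exact: bmeasM.
  - by apply: integD; apply: integ_bmeas; exact: bmeasM.
  - by apply: integD; apply: integ_bmeas; exact: bmeasM.
  by congr (_ ^+ 2 + _ ^+ 2); apply: (eq_prim pi_in) => t _; rewrite /f /g; ring.
apply: le_trans (lerD (sqr_prim_le pi_in bf) (sqr_prim_le pi_in bg)) _.
rewrite -mulrDr -!mulrA ler_wpM2l ?pi0// [prim (E _) pi * s]mulrC mulrA.
rewrite -(primD pi_in); [|exact: integ_sqr|exact: integ_sqr].
rewrite -(primZ _ pi_in); last exact: ac_energy_family.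
apply: (le_prim pi_in).
- by apply: integD; exact: integ_sqr.
- by apply: integZ; exact: ac_energy_family.
move=> t tpi; apply: (@le_trans _ _ (dE w r%:C t * E r%:C t)); last first.
  by rewrite ler_wpM2r ?energy_ge0// H.
rewrite /f /g /dE /E /energy /=.
move: (u1 w t - y1 t) (u2 w t - y2 t) (v1 w t - _) (v2 w t - _) => d1 d2 d3 d4.
move: (y1 t) (y2 t) (v1 _ t) (v2 _ t) => c1 c2 c3 c4.
rewrite -subr_ge0.
have -> : (d1 ^+ 2 + d3 ^+ 2 + d2 ^+ 2 + d4 ^+ 2) *
    (c1 ^+ 2 + c3 ^+ 2 + c2 ^+ 2 + c4 ^+ 2) -
    ((d1 * c1 + d2 * c2) ^+ 2 + (d3 * c1 + d4 * c2) ^+ 2) =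
  (d1 * c2 - d2 * c1) ^+ 2 + (d3 * c2 - d4 * c1) ^+ 2 +
    (d1 ^+ 2 + d3 ^+ 2 + d2 ^+ 2 + d4 ^+ 2) * (c3 ^+ 2 + c4 ^+ 2) by ring.
by rewrite !addr_ge0 ?sqr_ge0// mulr_ge0// !addr_ge0// sqr_ge0.
Qed.

(** Together with [prim_energy_gt0] this shows that the factor in
    [green_identity] does not vanish at r. *)
Lemma green_self : green r%:C = (prim (E r%:C) pi)%:C.
Proof.
rewrite /green; congr (_ +i* _).
  apply: (eq_prim pi_in) => t tpi; rewrite /E /energy.
  by have [-> ->] := real_im0 tpi; ring.
transitivity (prim (cst 0) pi : R); last by rewrite prim_cst ?mul0r ?pi0.
by apply: (eq_prim pi_in) => t tpi; have [-> ->] := real_im0 tpi; rewrite /cst; ring.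
Qed.

End RealPoint.
End DiracFamily.

(** * The zeros of z sin(pi z) *)

Section FreeZeros.
Context {R : realType}.
Local Notation C := R[i].
Local Notation pi0 := (@pi_ge0 R).
Local Notation integ := (integ pi).
Implicit Types z w : C.

Definition ch (t : R) := (expR t + expR (- t)) / 2.
Definition sh (t : R) := (expR t - expR (- t)) / 2.

Lemma ac_ch (c : R) : ac pi (fun x => ch (c * x)) (fun x => c * sh (c * x)).
Proof.
have a := acZ c (ac_id pi).
apply: (ac_eq (acZ 2^-1 (acD (ac_expR pi0 a) (ac_expR pi0 (acN a))))) => // x _.
  by rewrite /ch mulrC.
by rewrite /sh /cst /=; field.
Qed.

Lemma ac_sh (c : R) : ac pi (fun x => sh (c * x)) (fun x => c * ch (c * x)).
Proof.
have a := acZ c (ac_id pi).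
apply: (ac_eq (acZ 2^-1 (acB (ac_expR pi0 a) (ac_expR pi0 (acN a))))) => // x _.
  by rewrite /sh mulrC.
by rewrite /ch /cst /=; field.
Qed.

Let su1 (w : C) x := sin (complex.Re w * x) * ch (complex.Im w * x).
Let sv1 (w : C) x := cos (complex.Re w * x) * sh (complex.Im w * x).
Let su2 (w : C) x := - (cos (complex.Re w * x) * ch (complex.Im w * x)).
Let sv2 (w : C) x := sin (complex.Re w * x) * sh (complex.Im w * x).

(** The solution for the zero potential: at pi its first component is
    sin(pi w), so that the zeros of the sine obey the Green identity too. *)
Let free_sol w : dirac pi (cst 0) (cst 0) (complex.Re w) (complex.Im w)
  (su1 w) (sv1 w) (su2 w) (sv2 w).
Proof.
have a := acZ (complex.Re w) (ac_id pi).
have as_ := ac_sin pi0 a; have ac_ := ac_cos pi0 a.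
have ah := ac_ch (complex.Im w); have ak := ac_sh (complex.Im w).
split; rewrite /su1 /su2 /sv1 /sv2.
- by apply: (ac_eq (acM pi0 as_ ah)) => // x _; rewrite /cst; ring.
- by apply: (ac_eq (acM pi0 ac_ ak)) => // x _; rewrite /cst; ring.
- by apply: (ac_eq (acN (acM pi0 ac_ ah))) => // x _; rewrite /cst; ring.
- by apply: (ac_eq (acM pi0 as_ ak)) => // x _; rewrite /cst; ring.
Qed.

Let free_init w : [/\ su1 w 0 = 0, sv1 w 0 = 0, su2 w 0 = -1 & sv2 w 0 = 0].
Proof.
rewrite /su1 /su2 /sv1 /sv2 !mulr0 sin0 cos0 /sh /ch oppr0 expR0.
by split; field.
Qed.

Let integ0 : integ (cst 0 : R -> R) := integ_bmeas (bmeas_cst pi 0).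

Lemma csin_end w : csin (w * pi%:C) = end1 su1 sv1 w.
Proof.
by case: w => a b; rewrite /end1 /csin /su1 /sv1 /ch /sh /= !mulr0 subr0 add0r.
Qed.

Lemma lipschitz_csin z : lipschitz_near (fun w => csin (w * pi%:C)) z.
Proof.
rewrite (_ : (fun w => _) = end1 su1 sv1); last by apply/funext => w; exact: csin_end.
by have [] := end_lipschitz integ0 integ0 free_sol free_init z.
Qed.

(** In [green_identity] at r = n the real solution is (0, - cos(n pi)) at the
    endpoint, and cos(n pi) is its own inverse. *)
Lemma csin_factor (n : int) : exists g : C -> C,
  [/\ lipschitz_near g n%:~R, g n%:~R != 0 &
      forall w, csin (w * pi%:C) = (w - n%:~R) * g w].
Proof.
have nR : n%:~R = (n%:~R : R)%:C :> C := esym (rmorph_int (real_complex R) n).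
pose r : R := n%:~R; pose G := green su1 sv1 su2 sv2 r.
pose c : C := (cos (r * pi))%:C.
have c2 : c * c = 1.
  rewrite /c -rmorphM -expr2 cos2sin2 /r sin_int_pi expr0n subr0.
  by [].
have c0 : c != 0 by apply: contra_eq_neq c2 => ->; rewrite mulr0 eq_sym oner_eq0.
exists (fun w => c * G w); split.
- rewrite nR; apply: lipschitz_nearM; first exact: lipschitz_near_cst.
  by have := green_lipschitz integ0 integ0 free_sol free_init r.
- rewrite mulf_neq0// nR /G (green_self integ0 integ0 free_sol free_init).
  have := prim_energy_gt0 integ0 integ0 free_sol free_init r%:C.
  by move=> /lt0r_neq0 h; rewrite eq_complex /= (negPf h).
move=> w; rewrite csin_end nR mulrCA -(green_identity free_sol free_init).
have -> : su1 r%:C pi = 0 by rewrite /su1 /= sin_int_pi mul0r.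
have -> : su2 r%:C pi = - cos (r * pi).
  by rewrite /su2 /= mul0r /ch oppr0 expR0; field.
have -> : (- cos (r * pi))%:C = - c by rewrite /c rmorphN.
by rewrite rmorph0 -[LHS]mulr1 -c2; ring.
Qed.

Lemma csin_eq0 w : csin (w * pi%:C) = 0 -> exists n : int, w = n%:~R.
Proof.
case: w => a b /eqP; rewrite eq_complex /= !mulr0 subr0 add0r => /andP[/eqP s /eqP c].
have e1 := expR_gt0 (b * pi); have e2 := expR_gt0 (- (b * pi)).
have sa : sin (a * pi) = 0.
  move/eqP: s; rewrite mulf_eq0 => /orP[/eqP//|]; rewrite gt_eqF//.
  by rewrite divr_gt0// addr_gt0.
have pi_gt := pi_gt0 R.
have [n an] := sin_eq0_int sa; exists n.
have {}an : a = n%:~R by apply: (mulIf (lt0r_neq0 pi_gt)).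
have ca : cos (a * pi) != 0.
  apply/eqP => ca; have := cos2Dsin2 (a * pi); rewrite sa ca expr0n addr0.
  by move/eqP; rewrite eq_sym oner_eq0.
have /eqP : expR (b * pi) = expR (- (b * pi)).
  apply/eqP; rewrite -subr_eq0; move/eqP: c; rewrite mulf_eq0 (negPf ca)/=.
  by rewrite mulf_eq0 invr_eq0 pnatr_eq0 orbF.
move=> /eqP/expR_inj bb.
have b0 : b = 0.
  have /eqP : b * pi = 0 by lra.
  by rewrite mulf_eq0 (gt_eqF pi_gt) orbF => /eqP.
by rewrite an b0; exact: (rmorph_int (real_complex R)).
Qed.

Lemma lambda0_zeros :
  enumerates_zeros (fun z : C => z * csin (z * pi%:C)) (@lambda0 R).
Proof.
move=> z; have L : lipschitz_near (fun w : C => w * csin (w * pi%:C)) z.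
  by apply: lipschitz_nearM; [exact: lipschitz_near_id|exact: lipschitz_csin].
have lamE (i : eig_index) (n : int) :
    (lambda0 R i == n%:~R :> C) = (eig_number i == n).
  by rewrite /lambda0 eqr_int.
case: (pselect (exists n : int, z = n%:~R)) => [[n zn]|nz]; last first.
  exists 0%N; split.
    apply: (zero_order0 L); rewrite mulf_eq0 negb_or; apply/andP; split.
      by apply/eqP => z0; apply: nz; exists 0; rewrite z0.
    by apply/eqP => /csin_eq0.
  rewrite II0 card_eq0; apply/eqP; rewrite -subset0 => i /= iz.
  by apply: nz; exists (eig_number i); rewrite -iz.
have [g [Lg gn gE]] := csin_factor n.
have [n0|n0] := eqVneq n 0.
  exists 2%N; split.
    exists g; split; first by apply: lipschitz_near_continuous; rewrite zn.
      by rewrite zn.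
    by move=> w; rewrite gE zn n0 subr0 mulrA expr2.
  have -> : [set i | lambda0 R i = z] = [set Some 0; None].
    apply/seteqP; split=> i /=.
      move/eqP; rewrite zn lamE n0; case: i => [m|] /=; last by right.
      by move=> /eqP ->; left.
    by rewrite zn n0 => -[->|->].
  apply/eq_cardSP; exists None; first by right.
  rewrite (_ : _ `\` _ = [set Some 0]); first exact: card_set1.
  by apply/seteqP; split=> i /= => [[[->|->] //]|->]; split => //; left.
exists 1%N; split.
  exists (fun w => w * g w); split.
  - apply: lipschitz_near_continuous; rewrite zn.
    by apply: lipschitz_nearM => //; exact: lipschitz_near_id.
  - by rewrite zn mulf_neq0// intr_eq0.
  - by move=> w; rewrite gE zn expr1 mulrCA.
have -> : [set i | lambda0 R i = z] = [set Some n].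
  apply/seteqP; split=> i /=.
    move/eqP; rewrite zn lamE; case: i => [m|] /=; first by move=> /eqP ->.
    by rewrite eq_sym (negPf n0).
  by rewrite zn => ->.
exact: card_set1.
Qed.

End FreeZeros.

(** * The characteristic function *)

Section CharacteristicFunction.
Context {R : realType}.
Local Notation C := R[i].
Local Notation pi0 := (@pi_ge0 R).
Variables (p q : R -> R) (h1 h2 : R) (phi : R -> C -> 'cV[C]_2).
Hypotheses (hp : L2_0pi p) (hq : L2_0pi q) (hh2 : 0 < h2) (hphi : is_phi p q phi).

Local Notation p0 := (clip p).
Local Notation q0 := (clip q).
Let ip := integ_clip hp.
Let iq := integ_clip hq.

Definition phi_re1 (w : C) := re_part (fun x => phi x w 0 0).
Definition phi_im1 (w : C) := im_part (fun x => phi x w 0 0).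
Definition phi_re2 (w : C) := re_part (fun x => phi x w 1 0).
Definition phi_im2 (w : C) := im_part (fun x => phi x w 1 0).

Local Notation u1 := phi_re1.
Local Notation v1 := phi_im1.
Local Notation u2 := phi_re2.
Local Notation v2 := phi_im2.
Local Notation Delta := (char_fun h1 h2 phi).

Lemma phi_dirac w : dirac pi p0 q0 (complex.Re w) (complex.Im w)
  (u1 w) (v1 w) (u2 w) (v2 w).
Proof. by have := solution_dirac hp hq (hphi w).1. Qed.

Lemma phi_init w : [/\ u1 w 0 = 0, v1 w 0 = 0, u2 w 0 = -1 & v2 w 0 = 0].
Proof.
rewrite /u1 /v1 /u2 /v2 /re_part /im_part (hphi w).2 /col2 !mxE /=.
by rewrite oppr0.
Qed.

Lemma phi_real r x : x \in `[0, pi] -> phi x r%:C 0 0 = (u1 r%:C x)%:C /\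
  phi x r%:C 1 0 = (u2 r%:C x)%:C.
Proof.
move=> xpi; have [] := real_im0 ip iq phi_dirac phi_init r xpi.
rewrite /u1 /v1 /u2 /v2 /re_part /im_part.
by case: (phi x _ 0 0) (phi x _ 1 0) => [a b] [c d] /= -> ->.
Qed.

Lemma char_funE w : Delta w = (w + h1%:C) * end1 u1 v1 w + h2%:C * end2 u2 v2 w.
Proof.
rewrite /char_fun /end1 /end2 /u1 /v1 /u2 /v2 /re_part /im_part.
by case: (phi pi w 0 0) (phi pi w 1 0) => [a b] [c d].
Qed.

Lemma char_fun_lipschitz z : lipschitz_near Delta z.
Proof.
have [L1 L2] := end_lipschitz ip iq phi_dirac phi_init z.
rewrite (_ : Delta = fun w => (w + h1%:C) * end1 u1 v1 w + h2%:C * end2 u2 v2 w).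
  apply: lipschitz_nearD; apply: lipschitz_nearM => //.
    by apply: lipschitz_nearD; [exact: lipschitz_near_id|exact: lipschitz_near_cst].
  exact: lipschitz_near_cst.
by apply/funext => w; exact: char_funE.
Qed.

(** Green's identity gives Im w (h2 int |phi|^2 + |phi1(pi)|^2) = 0 at a zero w
    of the characteristic function. *)
Lemma char_fun_zero_real w : Delta w = 0 -> complex.Im w = 0.
Proof.
rewrite char_funE /end1 /end2; have := prim_energy_gt0 ip iq phi_dirac phi_init w.
have E0 := ac_energy_family phi_dirac w.
have [_ /(_ pi (pi_in))] := dirac_im_wronskian pi0 (phi_dirac w).
have [-> -> -> ->] := phi_init w; rewrite (primZ _ pi_in)// mul0r mulr0 subrr add0r.
move: (prim _ pi) => I.
case: w {E0} => a b /= ; move: (u1 _ pi) (v1 _ pi) (u2 _ pi) (v2 _ pi) => r s t v W I0.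
move/eqP; rewrite eq_complex /= => /andP[/eqP H1 /eqP H2].
have : b * (h2 * I + (r ^+ 2 + s ^+ 2)) = 0.
  have -> : b * (h2 * I + (r ^+ 2 + s ^+ 2)) =
    h2 * (b * I) + b * (r ^+ 2 + s ^+ 2) by ring.
  rewrite -W.
  transitivity (r * ((a + h1) * s + (b + 0) * r + (h2 * v + 0 * t)) -
    s * ((a + h1) * r - (b + 0) * s + (h2 * t - 0 * v))); first by ring.
  by rewrite H1 H2; ring.
move/eqP; rewrite mulf_eq0 => /orP[/eqP//|].
by rewrite gt_eqF// ltr_pwDl ?mulr_gt0// addr_ge0 ?sqr_ge0.
Qed.

(** The boundary condition at r eliminates the second component at pi from
    [green_identity].  The first component does not vanish there, since
    otherwise the second one would vanish as well. *)
Lemma char_fun_zero_simple r : Delta r%:C = 0 -> zero_order Delta r%:C 1.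
Proof.
move=> D0; pose y1 := u1 r%:C pi; pose y2 := u2 r%:C pi.
have [z1 z2] := real_im0 ip iq phi_dirac phi_init r pi_in.
have bc : (r + h1) * y1 + h2 * y2 = 0.
  move: D0; rewrite char_funE /end1 /end2 z1 z2 => /eqP.
  rewrite eq_complex /= => /andP[/eqP e _]; rewrite -[RHS]e /y1 /y2; ring.
have y10 : y1 != 0.
  apply/eqP => y10; have := energy_gt0 ip iq phi_dirac phi_init r%:C pi_in.
  rewrite /energy z1 z2 -/y1 -/y2 y10.
  move: bc; rewrite y10 mulr0 add0r => /eqP; rewrite mulf_eq0 (gt_eqF hh2)/=.
  by move=> /eqP ->; rewrite expr0n /= !addr0 ltxx.
have y1C : y1%:C != 0 :> C by rewrite eq_complex /= (negPf y10).
pose G := green u1 v1 u2 v2 r.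
pose g w := y1%:C^-1 * (h2%:C * G w + y1%:C * end1 u1 v1 w).
have [L1 L2] := end_lipschitz ip iq phi_dirac phi_init r%:C.
exists g; split.
- apply: lipschitz_near_continuous; rewrite /g.
  apply: lipschitz_nearM; first exact: lipschitz_near_cst.
  apply: lipschitz_nearD; apply: lipschitz_nearM => //; try exact: lipschitz_near_cst.
  by have := green_lipschitz ip iq phi_dirac phi_init r.
- rewrite /g mulf_neq0 ?invr_eq0// /G (green_self ip iq phi_dirac phi_init).
  rewrite /end1 -/y1 z1.
  have := prim_energy_gt0 ip iq phi_dirac phi_init r%:C.
  move: (prim _ pi) => I I0.
  rewrite eq_complex /= !mul0r !mulr0 !subr0 !addr0 eqxx andbT.
  by rewrite gt_eqF// ltr_pwDl ?mulr_gt0// -expr2 sqr_ge0.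
move=> w; rewrite expr1 /g.
have GI := green_identity phi_dirac phi_init r w; rewrite -/y1 -/y2 -/G in GI.
have bcC : h2%:C * y2%:C = - ((r%:C + h1%:C) * y1%:C) :> C.
  apply/eqP; rewrite -subr_eq0 opprK; apply/eqP.
  by rewrite -!rmorphD -!rmorphM -rmorphD/= addrC bc.
rewrite char_funE; apply: (mulfI y1C).
rewrite mulrCA [y1%:C * (y1%:C^-1 * _)]mulrA mulfV// mul1r.
have -> : (w - r%:C) * (h2%:C * G w + y1%:C * end1 u1 v1 w) =
    h2%:C * ((w - r%:C) * G w) + (w - r%:C) * y1%:C * end1 u1 v1 w by ring.
rewrite -GI.
have -> : h2%:C * (end2 u2 v2 w * y1%:C - end1 u1 v1 w * y2%:C) =
    h2%:C * end2 u2 v2 w * y1%:C - end1 u1 v1 w * (h2%:C * y2%:C) by ring.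
by rewrite bcC; ring.
Qed.

Lemma char_fun_zero_eigenfunction w : Delta w = 0 ->
  bvp_eigenfunction p q h1 h2 w (phi ^~ w).
Proof.
move=> Dw; have [sw iw] := hphi w; split=> //.
- by rewrite iw /col2 mxE.
- exists 0; first by rewrite in_itv/= lexx pi0.
  apply/eqP => /(congr1 (fun M : 'cV[C]_2 => M 1 0)).
  by rewrite iw /col2 !mxE /= => /eqP; rewrite oppr_eq0 oner_eq0.
Qed.

(** A solution whose first component vanishes at 0 is a multiple of phi, by
    uniqueness for the initial value problem. *)
Lemma eigenvalue_char_fun w : bvp_eigenvalue p q h1 h2 w <-> Delta w = 0.
Proof.
split=> [[y [sy y0 by_ [x xpi yx]]]|Dw]; last first.
  by exists (phi ^~ w); exact: char_fun_zero_eigenfunction.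
have dy := solution_dirac hp hq sy.
have [e1 e2 e3 e4] := phi_dirac w.
pose c := complex.Re (y 0 1 0); pose d := complex.Im (y 0 1 0).
(* y is minus (c + i d) times phi, as the second component of phi is - 1 at 0 *)
have dc : dirac pi p0 q0 (complex.Re w) (complex.Im w)
    (fun x => - c * u1 w x + d * v1 w x) (fun x => - c * v1 w x - d * u1 w x)
    (fun x => - c * u2 w x + d * v2 w x) (fun x => - c * v2 w x - d * u2 w x).
  split.
  - by apply: (ac_eq (acD (acZ (- c) e1) (acZ d e2))) => // t _; ring.
  - by apply: (ac_eq (acB (acZ (- c) e2) (acZ d e1))) => // t _; ring.
  - by apply: (ac_eq (acD (acZ (- c) e3) (acZ d e4))) => // t _; ring.
  - by apply: (ac_eq (acB (acZ (- c) e4) (acZ d e3))) => // t _; ring.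
have yE t : t \in `[0, pi] -> y t 0 0 = - (c +i* d) * phi t w 0 0 /\
    y t 1 0 = - (c +i* d) * phi t w 1 0.
  move=> tpi; have [i1 i2 i3 i4] := phi_init w.
  have [||||k1 k2 k3 k4] := dirac_unique pi0 ip iq dy dc _ _ _ _ tpi.
  - by rewrite i1 i2 /re_part y0 /=; ring.
  - by rewrite i1 i2 /im_part y0 /=; ring.
  - by rewrite i3 i4 /re_part -/c; ring.
  - by rewrite i3 i4 /im_part -/d; ring.
  move: k1 k2 k3 k4; rewrite /u1 /v1 /u2 /v2 /re_part /im_part.
  case: (y t 0 0) (y t 1 0) (phi t w 0 0) (phi t w 1 0) =>
    [a1 b1] [a2 b2] [a3 b3] [a4 b4] /=.
  move=> -> -> -> ->; split; apply/eqP; rewrite eq_complex /=; apply/andP; split;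
    apply/eqP; ring.
have [y1 y2] := yE pi pi_in.
have cd0 : c +i* d != 0.
  apply: contra_neq yx => cd; have [z1 z2] := yE x xpi.
  rewrite cd oppr0 !mul0r in z1 z2.
  apply/matrixP => i j; rewrite (ord1 j) mxE.
  have [->|->] : i = 0 \/ i = 1; [|exact: z1|exact: z2].
  by case: i => [[|[|//]] ?]; [left|right]; exact: val_inj.
have : - (c +i* d) * Delta w = 0.
  by rewrite -by_ y1 y2 /char_fun; ring.
by move/eqP; rewrite mulf_eq0 oppr_eq0 (negPf cd0) => /eqP.
Qed.

Lemma phi_pruefer : exists th rh : R -> R -> R,
  (forall a, pruefer pi p0 q0 a (th a) (rh a)) /\
  forall a x, x \in `[0, pi] ->
    phi x a%:C 0 0 = (expR (rh a x) * sin (th a x))%:C /\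
    phi x a%:C 1 0 = (- (expR (rh a x) * cos (th a x)))%:C.
Proof.
have H a : exists t : (R -> R) * (R -> R), pruefer pi p0 q0 a t.1 t.2 /\
   forall x, x \in `[0, pi] ->
    phi x a%:C 0 0 = (expR (t.2 x) * sin (t.1 x))%:C /\
    phi x a%:C 1 0 = (- (expR (t.2 x) * cos (t.1 x)))%:C.
  have [i1 _ i3 _] := phi_init a%:C.
  have [th [rh [P Q]]] := pruefer_exists pi0 ip iq
    (real_solution phi_dirac a) i1 i3.
  exists (th, rh); split=> // x xpi; have [-> ->] := phi_real a xpi.
  by have [-> ->] := Q x xpi.
have [t tP] := boolp.choice H.
exists (fun a => (t a).1), (fun a => (t a).2).
by split=> a; [have [] := tP a | move=> x xpi; have [_ /(_ x xpi)] := tP a].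
Qed.

End CharacteristicFunction.

(** * The asymptotic formulas *)

Section Final.
Context {R : realType}.
Implicit Types (a b c x t r : R).

Lemma sin_lipschitz a b : `|sin a - sin b| <= `|a - b|.
Proof.
have [c [-> _ _]] := mean_value (F' := cos) b a (@is_derive_sin R).
by rewrite normrM ler_piMl// cos_max.
Qed.

Lemma cos_lipschitz a b : `|cos a - cos b| <= `|a - b|.
Proof.
have [c [-> _ _]] := mean_value (F' := fun x => - sin x) b a (@is_derive_cos R).
by rewrite normrM ler_piMl// normrN sin_max.
Qed.

Lemma expR_lipschitz0 K t : `|t| <= K -> `|expR t - 1| <= expR K * `|t|.
Proof.
move=> tK; have K0 : 0 <= K by exact: le_trans tK.
have [c [E _ cK]] := mean_value 0 t (@is_derive_expR R).
move: E; rewrite expR0 !subr0 => ->; rewrite normrM ler_wpM2r//.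
rewrite ger0_norm ?expR_ge0// ler_expR; apply: le_trans (ler_norm _) _.
by apply: cK => //; rewrite normr0.
Qed.

Lemma sqr_le_norm a b : `|a| <= `|b| -> a ^+ 2 <= b ^+ 2.
Proof.
move=> ab; rewrite -[a ^+ 2]real_normK ?num_real// -[b ^+ 2]real_normK ?num_real//.
by rewrite ler_sqr ?nnegrE.
Qed.

(** The radius is changed first, from exp(r) to 1, and then the angle. *)
Lemma polar_deviation K r t s : `|r| <= K ->
  (expR r * sin t - sin s) ^+ 2 + (cos s - expR r * cos t) ^+ 2 <=
    2 * (expR K ^+ 2 * r ^+ 2) + 4 * (t - s) ^+ 2.
Proof.
move=> rK; set e := expR r.
have e1 : (e - 1) ^+ 2 <= expR K ^+ 2 * r ^+ 2.
  rewrite -exprMn; apply: sqr_le_norm.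
  by rewrite normrM [`|expR K|]ger0_norm ?expR_ge0//; exact: expR_lipschitz0.
have s1 : (sin t - sin s) ^+ 2 <= (t - s) ^+ 2.
  by apply: sqr_le_norm; exact: sin_lipschitz.
have c1 : (cos t - cos s) ^+ 2 <= (t - s) ^+ 2.
  by apply: sqr_le_norm; exact: cos_lipschitz.
have se : ((e - 1) * sin t) ^+ 2 + ((e - 1) * cos t) ^+ 2 = (e - 1) ^+ 2.
  by rewrite !exprMn -mulrDr [sin _ ^+ 2 + _]addrC cos2Dsin2 mulr1.
have a1 : (e * sin t - sin s) ^+ 2 <=
    2 * ((e - 1) * sin t) ^+ 2 + 2 * (sin t - sin s) ^+ 2.
  rewrite -subr_ge0 (_ : _ - _ = ((e - 1) * sin t - (sin t - sin s)) ^+ 2).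
    exact: sqr_ge0.
  by ring.
have a2 : (cos s - e * cos t) ^+ 2 <=
    2 * ((e - 1) * cos t) ^+ 2 + 2 * (cos t - cos s) ^+ 2.
  rewrite -subr_ge0 (_ : _ - _ = ((e - 1) * cos t - (cos t - cos s)) ^+ 2).
    exact: sqr_ge0.
  by ring.
by lra.
Qed.

Lemma sqnorm_real a : sqnorm a%:C = a ^+ 2.
Proof. by rewrite /sqnorm /= expr0n addr0. Qed.

Lemma ell2_real (e : eig_index -> R) M :
  sums_below (fun i => e i ^+ 2) M -> ell2 (fun i => (e i)%:C).
Proof.
move=> eM; rewrite /ell2; apply: (@le_lt_trans _ _ M%:E); last exact: ltry.
by apply: esum_sums_below; apply: sums_below_le eM => i; rewrite sqnorm_real.
Qed.

End Final.

Unset Implicit Arguments.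

Theorem theorem1 (R : realType) (p q : R -> R) (h1 h2 : R)
  (hp : L2_0pi p) (hq : L2_0pi q) (hh2 : 0 < h2)
  (phi : R -> R[i] -> 'cV[R[i]]_2) (hphi : is_phi p q phi) :
  exists lambda : eig_index -> R[i],
    [/\ (* (i) *)
      [/\ enumerates_zeros (char_fun h1 h2 phi) lambda,
          (forall z, bvp_eigenvalue p q h1 h2 z <-> exists i, lambda i = z),
          enumerates_zeros (fun z : R[i] => z * csin (z * pi%:C))
            (@lambda0 R),
          (exists2 eps : eig_index -> R[i], ell2 eps &
             forall i, lambda i = lambda0 R i + eps i)
        & exists N : nat, forall i, (N <= `|eig_number i|)%N ->
            simple_zero (char_fun h1 h2 phi) (lambda i)],
      (* (ii) *)
      (forall i, bvp_eigenfunction p q h1 h2 (lambda i) (phi ^~ (lambda i))) /\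
      (exists zeta : eig_index -> R -> 'cV[R[i]]_2,
         (forall i x, x \in `[0, pi] ->
            phi x (lambda i) =
              col2 (sin ((eig_number i)%:~R * x))%:C
                   (- (cos ((eig_number i)%:~R * x))%:C) + zeta i x) /\
         exists2 M : R, 0 < M & forall x, x \in `[0, pi] ->
           (\esum_(i in [set: eig_index])
              (sqnorm (zeta i x 0 0) + sqnorm (zeta i x 1 0))%:E <= M%:E)%E)
    & (* (iii) *)
      exists2 tau : eig_index -> R, ell2 (fun i => (tau i)%:C) &
        forall i, normalizing_number h2 phi (lambda i) = pi + tau i].
Proof.
have pi0 := @pi_ge0 R; have pi_gt := pi_gt0 R.
have ip := integ_clip hp; have iq := integ_clip hq.
have ip2 := integ_clip_sqr hp; have iq2 := integ_clip_sqr hq.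
have [th [rh [thP phiE]]] := phi_pruefer hp hq hphi.
have [lam [lam_inj lam_zero [M M0 lamM] [C C0 lamC]]] :=
  eigenvalue_localisation ip iq thP h1 hh2.
have [K K0 remK] := remainder_summable ip iq ip2 iq2 M.
pose L := prim (fun t => `|clip p t| + `|clip q t|) pi.
pose eps i := lam i - (eig_number i)%:~R.
pose gap i := (eig_number i)%:~R * pi - th (lam i) pi.
pose lambda i : R[i] := (lam i)%:C.
pose rem (i : eig_index) x := remainder (clip p) (clip q) M (eig_number i) x.
have {}remK x : x \in `[0, pi] -> sums_below (fun i => rem i x) K by exact: remK.
have remP i x : x \in `[0, pi] ->
    (th (lam i) x - lam i * x) ^+ 2 <= rem i x /\ rh (lam i) x ^+ 2 <= rem i x.
  by move=> xpi; have := pruefer_remainder ip iq ip2 iq2 M0 (thP (lam i)) (lamM i) xpi.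
have rhL i x : x \in `[0, pi] -> `|rh (lam i) x| <= L by exact: amplitude_le.
have charE a : char_fun h1 h2 phi a%:C = 0 <->
    (a + h1) * sin (th a pi) - h2 * cos (th a pi) = 0.
  have [E1 E2] := phiE a pi pi_in.
  have -> : char_fun h1 h2 phi a%:C =
      (expR (rh a pi) * ((a + h1) * sin (th a pi) - h2 * cos (th a pi)))%:C.
    rewrite /char_fun E1 E2 -rmorphD -!rmorphM -rmorphD /=; congr (_ +i* _); ring.
  split=> [/eqP|->]; last by rewrite mulr0.
  by rewrite eq_complex /= eqxx andbT mulf_eq0 (gt_eqF (expR_gt0 _)) /= => /eqP.
have zeroE z : char_fun h1 h2 phi z = 0 <-> exists i, lambda i = z.
  split=> [zz|[i <-]]; last by apply/charE/lam_zero; exists i.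
  have zr : z = (complex.Re z)%:C.
    have := char_fun_zero_real hp hq hh2 hphi zz.
    by case: (z) => a b /= ->.
  have /charE/lam_zero[i iE] : char_fun h1 h2 phi (complex.Re z)%:C = 0 by rewrite -zr.
  by exists i; rewrite /lambda iE -zr.
have lambda_inj : injective lambda.
  by move=> i j; rewrite /lambda => -[]; exact: lam_inj.
have simple i : zero_order (char_fun h1 h2 phi) (lambda i) 1.
  by apply: (char_fun_zero_simple hp hq hh2 hphi); apply/zeroE; exists i.
(* the angle gaps are of order 1 / |n| *)
have gap_sum : sums_below (fun i => gap i ^+ 2) (C ^+ 2 * (2 * 4)).
  apply: sums_below_le (sums_belowZ (sqr_ge0 C)
    (sums_below_number (@sums_below_inv_sqr R))) => i.
  have n0 : 0 < 1 + `|eig_number i|%N%:R :> R by rewrite ltr_pwDl.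
  rewrite ler_pdivlMr ?exprn_gt0// -exprMn; apply: sqr_le_norm.
  by rewrite normrM (gtr0_norm n0) (ger0_norm C0); exact: lamC.
pose Kgap := C ^+ 2 * (2 * 4).
have Kgap0 : 0 <= Kgap by rewrite !mulr_ge0// sqr_ge0.
pose Keps := 2 * Kgap + 2 * K.
have Keps0 : 0 <= Keps by rewrite addr_ge0// mulr_ge0.
have eps_sum : sums_below (fun i => eps i ^+ 2) Keps.
  have two : 0 <= 2 :> R by [].
  apply: sums_below_le (sums_belowD (sums_belowZ two gap_sum)
    (sums_belowZ two (remK pi pi_in))) => i.
  have [r1 _] := remP i pi pi_in.
  (* eps collects the angle gap and the angle remainder at pi *)
  have E : eps i * pi = - (gap i) - (th (lam i) pi - lam i * pi).
    by rewrite /eps /gap; ring.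
  have : eps i ^+ 2 <= (eps i * pi) ^+ 2.
    rewrite exprMn ler_peMr ?sqr_ge0// expr_ge1//.
    by have := pi_ge2 R; lra.
  rewrite E; move: r1; move: (th _ _ - _) (gap i) (rem i pi) => P g r.
  by move: (sqr_ge0 (g - P)); lra.
exists lambda; split.
- split.
  + move=> z; have [/zeroE[i iz]|/eqP zz] := pselect (char_fun h1 h2 phi z = 0).
      exists 1%N; split; first by rewrite -iz.
      rewrite (_ : [set _ | _] = [set i]); first exact: card_set1.
      by apply/seteqP; split=> j /= => [|->//]; rewrite -iz => /lambda_inj.
    exists 0%N; split.
      by apply: (zero_order0 (char_fun_lipschitz h1 h2 hp hq hphi z)).
    rewrite II0 card_eq0; apply/eqP; rewrite -subset0 => i /= iz.
    by move/eqP: zz; apply; apply/zeroE; exists i.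
  + by move=> z; rewrite -zeroE; exact: eigenvalue_char_fun.
  + exact: lambda0_zeros.
  + exists (fun i => (eps i)%:C); first exact: ell2_real eps_sum.
    move=> i; rewrite /lambda /lambda0 -(rmorph_int (real_complex R)) -rmorphD /=.
    by rewrite /eps addrC subrK.
  + by exists 0%N => i _; exact: simple.
- split.
    move=> i; apply: (char_fun_zero_eigenfunction hphi).
    by apply/zeroE; exists i.
  pose zeta i x := phi x (lambda i) -
    col2 (sin ((eig_number i)%:~R * x))%:C (- (cos ((eig_number i)%:~R * x))%:C).
  exists zeta; split; first by move=> i x _; rewrite /zeta addrC subrK.
  pose B := 2 * expR L ^+ 2 * K + 8 * K + 8 * pi ^+ 2 * Keps.
  have B0 : 0 <= B by rewrite !addr_ge0// !mulr_ge0// ?sqr_ge0.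
  exists (B + 1); first by rewrite ltr_wpDl.
  move=> x xpi; apply: esum_sums_below.
  apply: (@sums_below_le _ _ _ (fun i => 2 * expR L ^+ 2 * rem i x +
     8 * rem i x + 8 * pi ^+ 2 * eps i ^+ 2)); last first.
    move=> s us; apply: (@le_trans _ _ B); last by rewrite lerDl.
    move: s us; apply: sums_belowD; last first.
      by apply: sums_belowZ => //; rewrite mulr_ge0// sqr_ge0.
    by apply: sums_belowD; apply: sums_belowZ; rewrite ?mulr_ge0 ?sqr_ge0//;
      exact: remK.
  move=> i; have [r1 r2] := remP i x xpi; have [E1 E2] := phiE (lam i) x xpi.
  have x_pi2 : x ^+ 2 <= pi ^+ 2.
    by move: xpi; rewrite in_itv/= => /andP[x0 x1]; rewrite ler_sqr ?nnegrE.
  set rho := rh (lam i) x in r2 E1 E2; set t := th (lam i) x in r1 E1 E2.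
  set n : R := (eig_number i)%:~R.
  have -> : zeta i x 0 0 = (expR rho * sin t - sin (n * x))%:C.
    by rewrite /zeta !mxE /= E1 rmorphB.
  have -> : zeta i x 1 0 = (cos (n * x) - expR rho * cos t)%:C.
    by rewrite /zeta !mxE /= E2 !rmorphB rmorphN opprK addrC.
  rewrite !sqnorm_real; have := polar_deviation t (n * x) (rhL i x xpi).
  rewrite -/rho; have tE : t - n * x = (t - lam i * x) + eps i * x.
    by rewrite /eps -/n; ring.
  have ex : (eps i * x) ^+ 2 <= pi ^+ 2 * eps i ^+ 2.
    by rewrite exprMn mulrC ler_wpM2r// sqr_ge0.
  have t2 : (t - n * x) ^+ 2 <= 2 * (t - lam i * x) ^+ 2 + 2 * (eps i * x) ^+ 2.
    by rewrite tE; move: (sqr_ge0 ((t - lam i * x) - eps i * x)); lra.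
  have e2 : expR L ^+ 2 * rho ^+ 2 <= expR L ^+ 2 * rem i x.
    by rewrite ler_wpM2l// sqr_ge0.
  by move: r1 ex t2 e2; lra.
(* |phi|^2 = exp(2 rh), so the normalizing number is pi plus the integral of f
   plus a boundary term *)
pose f i t := expR (2 * rh (lam i) t) - 1.
pose bdry i := h2^-1 * (expR (2 * rh (lam i) pi) * sin (th (lam i) pi) ^+ 2).
have bf i : bmeas pi (f i).
  have [_ _ _ arh] := thP (lam i).
  exact: bmeasB (ac_bmeas pi0 (ac_expR pi0 (acZ 2 arh))) (bmeas_cst pi 1).
have e2 (t : R) : expR t ^+ 2 = expR (2 * t) by rewrite mulrDl mul1r expRD expr2.
exists (fun i => prim (f i) pi + bdry i); last first.
  move=> i; rewrite /normalizing_number addrA; congr (_ + _).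
    transitivity (prim (fun t => 1 + f i t) pi).
      apply: (eq_prim pi_in) => t tpi; have [-> ->] := phiE (lam i) t tpi.
      rewrite !sqnorm_real sqrrN !exprMn -mulrDr [sin _ ^+ 2 + _]addrC cos2Dsin2 mulr1 e2.
      by rewrite /f addrC subrK.
    rewrite (primD pi_in) ?prim_cst ?mul1r//; last exact: integ_bmeas.
    exact/integ_bmeas/bmeas_cst.
  have [-> _] := phiE (lam i) pi pi_in.
  by rewrite sqnorm_real exprMn e2.
pose E2 := expR (2 * L) ^+ 2.
have rh2 i t : t \in `[0, pi] -> `|2 * rh (lam i) t| <= 2 * L.
  by move=> tpi; rewrite normrM normr_nat ler_wpM2l// rhL.
have f2 t : t \in `[0, pi] -> sums_below (fun i => f i t ^+ 2) (E2 * 4 * K).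
  move=> tpi; apply: sums_below_le (sums_belowZ _ (remK t tpi)) => [i|]; last first.
    by rewrite mulr_ge0// sqr_ge0.
  have [_ r2] := remP i t tpi.
  apply: (@le_trans _ _ (E2 * 4 * rh (lam i) t ^+ 2)); last first.
    by rewrite ler_wpM2l// mulr_ge0// sqr_ge0.
  have -> : E2 * 4 * rh (lam i) t ^+ 2 = (expR (2 * L) * (2 * rh (lam i) t)) ^+ 2.
    by rewrite /E2; ring.
  apply: sqr_le_norm; rewrite normrM [`|expR _|]ger0_norm ?expR_ge0//.
  by apply: expR_lipschitz0; exact: rh2.
have pf := sums_below_prim (fun i => integ_sqr (bf i)) f2.
apply: (@ell2_real _ _ (2 * (pi * (E2 * 4 * K * pi)) + 2 * ((h2^-1) ^+ 2 * E2) * Kgap)).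
have two : 0 <= 2 :> R by [].
have hE : 0 <= 2 * ((h2^-1) ^+ 2 * E2).
  by apply: mulr_ge0 => //; apply: mulr_ge0; exact: sqr_ge0.
apply: sums_below_le (sums_belowD (sums_belowZ two (sums_belowZ pi0 pf))
  (sums_belowZ hE gap_sum)) => i.
have b2 : bdry i ^+ 2 <= (h2^-1) ^+ 2 * E2 * gap i ^+ 2.
  rewrite /bdry exprMn -mulrA ler_wpM2l ?sqr_ge0// exprMn.
  apply: ler_pM; rewrite ?sqr_ge0//.
    rewrite ler_sqr ?nnegrE ?expR_ge0// ler_expR.
    by apply: le_trans (ler_norm _) (rh2 i pi pi_in).
  have s1 : sin (th (lam i) pi) ^+ 2 <= 1.
    by rewrite -(cos2Dsin2 (th (lam i) pi)) lerDr sqr_ge0.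
  apply: (@le_trans _ _ (sin (th (lam i) pi) ^+ 2)).
    by rewrite expr2 ler_piMr// sqr_ge0.
  (* th and the opposite of gap differ by a multiple of pi *)
  have -> : sin (th (lam i) pi) ^+ 2 = sin (gap i) ^+ 2.
    by rewrite /gap sinB sin_int_pi mul0r sub0r sqrrN exprMn cos2sin2 sin_int_pi
      expr0n subr0 mul1r.
  by apply: sqr_le_norm; have := sin_lipschitz (gap i) 0; rewrite sin0 !subr0.
have p2 := sqr_prim_le pi_in (bf i).
rewrite -[2 * (_ * E2) * _]mulrA.
move: b2 p2; move: (prim (f i) pi) (bdry i) (_ * E2 * _) (pi * _) => a b c d.
by move: (sqr_ge0 (a - b)); lra.
Qed.
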